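(* Let $\alpha$ be a non-zero algebraic number. Then there exist $N\in\mathbb{N}$ and $\alpha_1,\ldots,\alpha_N\in\mathrm{rad}(K_\alpha)$ such that $\alpha=\alpha_1\cdots\alpha_N$ and $M_1(\alpha)=M(\alpha_1)\cdots M(\alpha_N)$. In particular, the infimum defining $M_1(\alpha)$ is attained.
   Context: Let $\overline{\mathbb{Q}}$ be an algebraic closure of $\mathbb{Q}$. For a number field $K$ and a place $v$ of $K$ lying over the place $p$ of $\mathbb{Q}$, let $\|\cdot\|_v$ be the absolute value on the completion $K_v$ extending the usual $p$-adic (or real) absolute value on $\mathbb{Q}_p$, and set $|x|_v=\|x\|_v^{[K_v:\mathbb{Q}_p]/[K:\mathbb{Q}]}$. The (absolute multiplicative) Weil height of $x\in K$ is $H(x)=\prod_v\max\{1,|x|_v\}$, the product over all places $v$ of $K$; it is independent of $K$ and so defined on $\overline{\mathbb{Q}}$. The Mahler measure of $x\in\overline{\mathbb{Q}}$ is $M(x)=H(x)^{[\mathbb{Q}(x):\mathbb{Q}]}$. The metric Mahler measure of a non-zero algebraic number $\alpha$ is $$M_1(\alpha)=\inf\Big\{\prod_{n=1}^N M(\alpha_n): N\in\mathbb{N},\ \alpha_n\in\overline{\mathbb{Q}}^\times,\ \alpha=\prod_{n=1}^N\alpha_n\Big\}.$$ For a non-zero algebraic number $\alpha$, $K_\alpha$ denotes the Galois closure of $\mathbb{Q}(\alpha)$ over $\mathbb{Q}$. For a number field $K$, $\mathrm{rad}(K)=\{x\in\overline{\mathbb{Q}}^\times: x^r\in K \text{ for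 some } r\in\mathbb{N}\}$. *)

(* Defs.v *)
From HB Require Import structures.
From mathcomp Require Import all_boot all_order all_algebra all_field.
From mathcomp Require Import generic_quotient ring_quotient.
From mathcomp Require Import boolp classical_sets functions cardinality fsbigop.
From mathcomp Require Import reals exp.
From mathcomp Require Import ring.

Set Implicit Arguments.
Unset Strict Implicit.
Unset Printing Implicit Defensive.

Import Order.TTheory GRing.Theory Num.Theory.

Local Open Scope classical_set_scope.
Local Open Scope ring_scope.
Local Open Scope quotient_scope.

Record absval (R : realType) (F : fieldType) := AbsVal {
  absval_fun :> F -> R ;
  absval_ge0 : forall x, 0 <= absval_fun x ;
  absval_eq0 : forall x, absval_fun x = 0 -> x = 0 ;
  absval0 : absval_fun 0 = 0 ;
  absvalM : forall x y, absval_fun (x * y) = absval_fun x * absval_fun y ;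
  absvalD : forall x y, absval_fun (x + y) <= absval_fun x + absval_fun y }.

Section Completion.

Variables (R : realType) (F : fieldType) (v : absval R F).

Definition cauchy_sequence (u : nat -> F) : Prop :=
  forall e : R, 0 < e ->
    exists N, forall m n, (N <= m)%N -> (N <= n)%N -> v (u m - u n) < e.

Definition null_sequence (u : nat -> F) : Prop :=
  forall e : R, 0 < e -> exists N, forall n, (N <= n)%N -> v (u n) < e.

Lemma absval1 : v 1 = 1.
Proof.
have h : v 1 * v 1 = v 1 * 1 by rewrite -absvalM !mulr1.
apply: mulfI h; apply/eqP => /absval_eq0 /eqP.
by rewrite oner_eq0.
Qed.

Lemma absvalN x : v (- x) = v x.
Proof.
have h : v (-1) = 1.
  apply/eqP; rewrite -(eqrXn2 (_ : 0 < 2)%N) ?absval_ge0 ?ler01 //.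
  by rewrite expr1n expr2 -absvalM mulrNN mulr1 absval1.
by rewrite -mulN1r absvalM h mul1r.
Qed.

Lemma absvalV x : v x^-1 = (v x)^-1.
Proof.
have [->|x0] := eqVneq x 0; first by rewrite invr0 absval0 invr0.
have vx0 : v x != 0 by apply: contra_neq x0 => /absval_eq0.
by apply: (mulfI vx0); rewrite -absvalM !mulfV ?absval1.
Qed.

Lemma absvalB x y : v (x - y) <= v x + v y.
Proof. by rewrite (le_trans (absvalD v _ _)) ?absvalN. Qed.

Lemma cauchy_bounded u : cauchy_sequence u ->
  exists2 B : R, 0 < B & forall n, v (u n) <= B.
Proof.
move=> /(_ 1 ltr01)[N hN]; pose B := \sum_(i < N.+1) v (u i) + 1.
have le_sum k : (k < N.+1)%N -> v (u k) <= \sum_(i < N.+1) v (u i).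
  move=> kN; rewrite (bigD1 (Ordinal kN)) //= lerDl sumr_ge0 // => i _.
  exact: absval_ge0.
exists B; first by rewrite ltr_pwDr ?sumr_ge0 // => i _; apply: absval_ge0.
move=> n; have [nN|Nn] := ltnP n N.+1.
  by rewrite (le_trans (le_sum _ nN)) // lerDl.
rewrite -[u n](subrK (u N)) (le_trans (absvalD v _ _)) // addrC lerD ?le_sum //.
by rewrite ltW // hN // ltnW.
Qed.

Definition cauchy_pred : pred (nat -> F) := fun u => `[< cauchy_sequence u >].

Lemma cauchy_subring : subring_closed cauchy_pred.
Proof.
split.
- apply/asboolP => e e0; exists 0%N => m n _ _.
  by rewrite subrr absval0.
- move=> x y /asboolP cx /asboolP cy; apply/asboolP => e e0.
  have e20 : 0 < e / 2 by rewrite divr_gt0.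
  have [N1 h1] := cx _ e20; have [N2 h2] := cy _ e20.
  exists (maxn N1 N2) => m n; rewrite !geq_max => /andP[a b] /andP[c d].
  have -> : (x - y) m - (x - y) n = (x m - x n) - (y m - y n).
    by rewrite !fctE; ring.
  rewrite (le_lt_trans (absvalB _ _)) // [ltRHS]splitr ltrD ?h1 ?h2 //.
- move=> x y /asboolP cx /asboolP cy; apply/asboolP => e e0.
  have [B B0 hB] := cauchy_bounded cx; have [C C0 hC] := cauchy_bounded cy.
  have [N1 h1] := cx _ (divr_gt0 (divr_gt0 e0 (ltr0Sn R 1)) C0 : 0 < e / 2 / C).
  have [N2 h2] := cy _ (divr_gt0 (divr_gt0 e0 (ltr0Sn R 1)) B0 : 0 < e / 2 / B).
  exists (maxn N1 N2) => m n; rewrite !geq_max => /andP[a b] /andP[c d].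
  have -> : (x * y) m - (x * y) n = (x m - x n) * y m + (y m - y n) * x n.
    by rewrite !fctE; ring.
  rewrite (le_lt_trans (absvalD v _ _)) // !absvalM [ltRHS]splitr ltrD //.
    rewrite (le_lt_trans (ler_wpM2l (absval_ge0 v _) (hC _))) //.
    by rewrite -ltr_pdivlMr ?h1.
  rewrite (le_lt_trans (ler_wpM2l (absval_ge0 v _) (hB _))) //.
  by rewrite -ltr_pdivlMr ?h2.
Qed.

HB.instance Definition _ :=
  GRing.isSubringClosed.Build (nat -> F) cauchy_pred cauchy_subring.

Record cauchy_seq := CauchySeq {
  cauchy_val :> nat -> F ;
  _ : cauchy_val \in cauchy_pred }.

HB.instance Definition _ := [isSub for cauchy_val].
HB.instance Definition _ := [Choice of cauchy_seq by <:].
HB.instance Definition _ := [SubChoice_isSubComNzRing of cauchy_seq by <:].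

Definition null_pred : {pred cauchy_seq} := fun u => `[< null_sequence u >].

Lemma null_ideal : idealr_closed null_pred.
Proof.
split.
- by apply/asboolP => e e0; exists 0%N => n _; rewrite absval0.
- apply/asboolP => /(_ 1 ltr01)[N /(_ N (leqnn N))].
  by rewrite absval1 ltxx.
- move=> a x y /asboolP cx /asboolP cy; apply/asboolP => e e0.
  have /asboolP ca := valP a.
  have [B B0 hB] := cauchy_bounded ca.
  have [N1 h1] := cx _ (divr_gt0 (divr_gt0 e0 (ltr0Sn R 1)) B0 : 0 < e / 2 / B).
  have [N2 h2] := cy _ (divr_gt0 e0 (ltr0Sn R 1) : 0 < e / 2).
  exists (maxn N1 N2) => n; rewrite !geq_max => /andP[b c].
  rewrite (le_lt_trans (absvalD v _ _)) // [ltRHS]splitr ltrD ?h2 //.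
  rewrite absvalM mulrC.
  rewrite (le_lt_trans (ler_wpM2l (absval_ge0 v _) (hB _))) //.
  by rewrite -ltr_pdivlMr ?h1.
Qed.

HB.instance Definition _ := isIdealr.Build cauchy_seq null_pred null_ideal.

Definition completion := {ideal_quot (null_pred : idealr cauchy_seq)}.

HB.instance Definition _ := GRing.ComNzRing.on completion.

Lemma cauchy_away (u : nat -> F) : cauchy_sequence u -> ~ null_sequence u ->
  exists2 c : R, 0 < c & exists N, forall n, (N <= n)%N -> c <= v (u n).
Proof.
move=> cu /existsNP[e /not_implyP[e0 /forallNP hN]].
have [N1 h1] := cu _ (divr_gt0 e0 (ltr0Sn R 1) : 0 < e / 2).
have /existsNP[m /not_implyP[N1m /negP]] := hN N1; rewrite -leNgt => em.
exists (e / 2); first by rewrite divr_gt0.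
exists N1 => n N1n; rewrite -(lerD2l (e / 2)) -splitr (le_trans em) //.
by rewrite -[u m](subrK (u n)) (le_trans (absvalD v _ _)) // lerD // ltW ?h1.
Qed.

Lemma cauchy_inv (u : nat -> F) : cauchy_sequence u -> ~ null_sequence u ->
  cauchy_sequence (fun n => (u n)^-1).
Proof.
move=> cu nu; have [c c0 [N hN]] := cauchy_away cu nu => e e0.
have [N1 h1] := cu _ (mulr_gt0 e0 (mulr_gt0 c0 c0)).
exists (maxn N N1) => m n; rewrite !geq_max => /andP[Nm N1m] /andP[Nn N1n].
have vne0 k : (N <= k)%N -> u k != 0.
  by move=> /hN; apply: contraTneq => ->; rewrite absval0 -ltNge.
have -> : (u m)^-1 - (u n)^-1 = (u n - u m) / (u m * u n).
  by field; rewrite !vne0.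
rewrite absvalM absvalV absvalM.
have cc : c * c <= v (u m) * v (u n) by rewrite ler_pM ?hN // ltW.
rewrite ltr_pdivrMr ?(lt_le_trans _ cc) ?mulr_gt0 //.
by rewrite (lt_le_trans (h1 _ _ N1n N1m)) // ler_pM2l.
Qed.

Lemma completion_inv_ex (x : completion) : x != 0 -> exists y, y * x = 1.
Proof.
elim/quotW: x => u.
rewrite -(rmorph0 \pi_(completion)) -Quotient.idealrBE subr0.
move=> /asboolPn nu; have /asboolP cu := valP u.
have cw : (fun n => (u n)^-1) \in cauchy_pred.
  by apply/asboolP; exact: cauchy_inv.
exists (\pi_(completion) (CauchySeq cw)).
rewrite -rmorphM -(rmorph1 \pi_(completion)).
apply/eqP; rewrite -Quotient.idealrBE; apply/asboolP => e e0.
have [c c0 [N hN]] := cauchy_away cu nu; exists N => n Nn.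
have un0 : u n != 0.
  apply/eqP => un0; have : c <= v (u n) := hN n Nn.
  by rewrite un0 absval0 leNgt c0.
by rewrite /= !fctE /= mulVf // subrr absval0.
Qed.

Definition completion_inv (x : completion) : completion :=
  xget 0 [set y | y * x = 1].

Lemma completion_mulVf (x : completion) : x != 0 -> completion_inv x * x = 1.
Proof.
move=> /completion_inv_ex[y yx]; rewrite /completion_inv.
by case: xgetP => [_ _ //|/(_ y)].
Qed.

Lemma completion_inv0 : completion_inv 0 = 0.
Proof.
rewrite /completion_inv; case: xgetP => // y _ /=.
by rewrite mulr0 => /esym /eqP; rewrite oner_eq0.
Qed.

HB.instance Definition _ :=
  GRing.ComNzRing_isField.Build completion completion_mulVf completion_inv0.

End Completion.

Definition is_basis_over (L : fieldType) (k : set L) (d : nat)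
    (b : 'I_d -> L) : Prop :=
  forall y : L, exists! c : {ffun 'I_d -> L},
    (forall i, k (c i)) /\ y = \sum_i c i * b i.

Definition padic_abs (R : realType) (p : nat) (q : rat) : R :=
  if q == 0 then 0
  else p%:R ^ ((logn p `|denq q|)%:Z - (logn p `|numq q|)%:Z).

Section Height.

Variables (R : realType) (K : fieldExtType rat).

(* Every place of K contains exactly one absolute value that restricts to the
   usual absolute value of a place of Q; it represents the place. *)
Record place := Place {
  place_abs :> absval R K ;
  place_over :
    (forall q : rat, place_abs q%:A = `|ratr q|) \/
    (exists2 p, prime p & forall q : rat, place_abs q%:A = padic_abs R p q) }.

HB.instance Definition _ := gen_eqMixin place.
HB.instance Definition _ := gen_choiceMixin place.

(* The copy of Q_p inside K_v: classes of Cauchy sequences of rationals. *)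
Definition rat_completion (v : place) : set (completion v) :=
  [set y | exists u : cauchy_seq v,
     (forall n, exists q : rat, u n = q%:A) /\ y = \pi_(completion v) u].

Arguments rat_completion : clear implicits.

Definition local_degree (v : place) : nat :=
  xget 0%N [set d | exists b : 'I_d -> completion v,
                      is_basis_over (rat_completion v) b].

Definition normalized_abs (v : place) (x : K) : R :=
  v x `^ ((local_degree v)%:R / (\dim {:K})%:R).

(* All but finitely many factors are 1, so this finitely supported product is
   the full product over the places of K. *)
Definition field_height (x : K) : R :=
  \big[*%R/1]_(v \in [set: place]) Num.max 1 (normalized_abs v x).

End Height.

Section AlgebraicNumbers.

Variable x : algC.

(* Q(x), as an abstract extension of Q, and its generator corresponding to x *)
Definition adjoin_field : fieldExtType rat := projT1 (num_field_exists [:: x]).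

Definition adjoin_gen : adjoin_field :=
  head 0 (s2val (projT2 (projT2 (num_field_exists [:: x])))).

Definition adjoin_emb : {rmorphism adjoin_field -> algC} :=
  projT1 (projT2 (num_field_exists [:: x])).

Lemma adjoin_genP : adjoin_emb adjoin_gen = x.
Proof.
rewrite /adjoin_gen /adjoin_emb.
case: (projT2 (projT2 (num_field_exists [:: x]))) => s1 /=.
by case: s1 => [//|a s [-> _]].
Qed.

Lemma adjoin_gen_full : <<1; adjoin_gen>>%VS = fullv.
Proof.
rewrite /adjoin_gen.
case: (projT2 (projT2 (num_field_exists [:: x]))) => s1 /=.
by case: s1 => [//|a [|b s] //= _]; rewrite adjoin_seq1.
Qed.

End AlgebraicNumbers.

Definition weil_height (R : realType) (x : algC) : R :=
  field_height R (adjoin_gen x).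

Definition mahler (R : realType) (x : algC) : R :=
  weil_height R x ^+ \dim {:adjoin_field x}.

Definition mahler_products (R : realType) (alpha : algC) : set R :=
  [set m | exists N (a : 'I_N -> algC),
     [/\ (0 < N)%N, forall n, a n != 0, alpha = \prod_n a n
       & m = \prod_n mahler R (a n)]].

Arguments mahler_products : clear implicits.

Definition metric_mahler (R : realType) (alpha : algC) : R :=
  inf (mahler_products R alpha).

(* The smallest Galois extension of Q inside algC that contains alpha. *)
Definition galois_closure (alpha : algC) : set algC :=
  [set x | forall (L : splittingFieldType rat) (f : {rmorphism L -> algC}),
     galois 1 {:L} -> range f alpha -> range f x].

Definition rad_field (K : set algC) : set algC :=
  [set x | x != 0 /\ exists2 r, (0 < r)%N & K (x ^+ r)].

(* Main.v *)
(** For every absolute value [w] of [algC] over a place of [rat] let [mu_w x] be the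
    product of [max 1 (w y)] over the conjugates [y] of [x].
    Places [v] of [rat(x)] over [w] correspond to classes of conjugates of [x], the
    local degree of [v] being the number of conjugates in its class: the completion
    at [v] is generated by [x] over the completion of [rat], and an absolute value
    of a complete field extends uniquely to a finite extension.  Hence
    [mahler x = \prod_w mu_w x].

    Let [K] be the Galois closure of [rat(alpha)] and [alpha = \prod a_n].  If [c_n]
    is the product of the [d_n] conjugates of [a_n] over [K], then [c_n] lies in [K]
    and [mu_w c_n <= mu_w a_n], because distinct conjugates of [c_n] are products of
    disjoint blocks of conjugates of [a_n].  If [b_n] is a [d_n]-th root of [c_n] then
    [mu_w b_n <= mu_w c_n], and taking norms to [K] shows that [alpha] is [\prod b_n]
    times a root of unity, whose Mahler measure is [1].  The measures of the elements
    of [K] form a discrete set (Northcott), so the products [\prod mahler c_n] also do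
    and their infimum is attained. *)

Require Import Defs.
From HB Require Import structures.
From mathcomp Require Import all_boot all_order all_fingroup all_algebra all_field.
From mathcomp Require Import generic_quotient ring_quotient.
From mathcomp Require Import boolp classical_sets functions cardinality fsbigop.
From mathcomp Require Import reals topology normedtype sequences exp.
From mathcomp Require Import ring lra.

Set Implicit Arguments.
Unset Strict Implicit.
Unset Printing Implicit Defensive.

Import Order.TTheory GRing.Theory Num.Theory numFieldNormedType.Exports.

Local Open Scope classical_set_scope.
Local Open Scope ring_scope.
Local Open Scope quotient_scope.

(** * Completions *)

(** The numbers to be compared generate different fields, so their measures are split along absolute
    values of [algC], one fixed [w] for each place of [rat]: inequalities between the local factors
    at every [w] multiply up to an inequality of measures. At a prime such a [w] has to be
    constructed first.

    The radicals [b_n] cannot be fed to Northcott's theorem: their degrees are not bounded, because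
    the [d_n] are not. The norms [c_n] have degree at most that of [K], so it is the products of the
    [mahler c_n] that form a discrete set. Each such product lies between the given product of the
    [mahler a_n] above and a value realised by radicals below, and this sandwich transfers the
    minimum.

    The number of factors is not bounded either. Discreteness survives because the finitely many
    measures below a bound leave a gap above 1, so that only boundedly many factors differ from
    1. *)

Lemma invS_small (R : realType) (e : R) : 0 < e ->
  exists N, forall n, (N <= n)%N -> n.+1%:R^-1 < e :> R.
Proof.
move=> e0; exists (Num.truncn e^-1) => n Nn.
rewrite invf_plt ?posrE // (lt_le_trans (truncnS_gt _)) //.
by rewrite ler_nat ltnS.
Qed.

Lemma absval_le_sub (R : realType) (F : fieldType) (w : absval R F) x y :
  `|w x - w y| <= w (x - y).
Proof.
have h a b : w a - w b <= w (a - b).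
  by rewrite lerBlDr -{1}(subrK b a) absvalD.
by rewrite ler_norml h andbT lerNl opprB -[leRHS]absvalN opprB.
Qed.

Section CompletionAbs.

Variables (R : realType) (F : fieldType) (v : absval R F).

Lemma cauchy_absval_cvg (u : nat -> F) : cauchy_sequence v u ->
  cvgn (fun n => v (u n) : R).
Proof.
move=> cu; apply/cauchy_cvgP/cauchy_exP => e e0.
have [N hN] := cu e e0.
exists (v (u N)); exists N => // n /= Nn.
by rewrite /ball /= (le_lt_trans (absval_le_sub v _ _)) // hN.
Qed.

Lemma null_sequence_cvg (u : nat -> F) :
  null_sequence v u <-> (v (u n) @[n --> \oo] --> (0 : R)).
Proof.
split=> [nu|/cvgrPdist_lt cu e e0].
  apply/cvgrPdist_lt => e e0; have [N hN] := nu e e0.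
  by exists N => // n /= /hN; rewrite sub0r normrN ger0_norm ?absval_ge0.
have [N _ hN] := cu e e0; exists N => n /hN.
by rewrite sub0r normrN ger0_norm ?absval_ge0.
Qed.

Lemma completion_eqP (u w : cauchy_seq v) :
  \pi_(completion v) u = \pi_(completion v) w <->
  null_sequence v (fun n => u n - w n).
Proof.
split=> [/eqP|h]; first by rewrite -Quotient.idealrBE => /asboolP.
by apply/eqP; rewrite -Quotient.idealrBE; apply/asboolP.
Qed.

Lemma completion_eq0P (u : cauchy_seq v) :
  \pi_(completion v) u = 0 <-> null_sequence v u.
Proof.
rewrite -[0](rmorph0 \pi_(completion v)) completion_eqP.
suff -> : (fun n => u n - (0 : cauchy_seq v) n) = u by [].
by apply/funext => n; rewrite subr0.
Qed.

Definition completion_abs_fun (X : completion v) : R :=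
  lim (v (repr X n) @[n --> \oo] : set_system R).

(** The limit is defined along the chosen representative; another member of the class differs from
    it by a null sequence, so its absolute values have the same limit. *)
Lemma completion_abs_cvg (u : cauchy_seq v) :
  v (u n) @[n --> \oo] --> (completion_abs_fun (\pi u) : R).
Proof.
set r := repr (\pi_(completion v) u : completion v).
have /asboolP cr : (r : nat -> F) \in cauchy_pred v := valP r.
have h1 : v (r n) @[n --> \oo] --> (completion_abs_fun (\pi u) : R).
  exact: cauchy_absval_cvg cr.
have h2 : v (u n - r n) @[n --> \oo] --> (0 : R).
  by apply/null_sequence_cvg/completion_eqP; rewrite reprK.
have h3 : (v (u n) - v (r n)) @[n --> \oo] --> (0 : R).
  apply/cvgrPdist_lt => e e0; near=> n.
  rewrite sub0r normrN (le_lt_trans (absval_le_sub v _ _)) //.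
  rewrite -[X in X < _]ger0_norm ?absval_ge0 // -normrN -sub0r.
  by near: n; move/cvgrPdist_lt : h2; apply.
have -> : (fun n => v (u n)) = (fun n => v (u n) - v (r n)) \+ (fun n => v (r n)).
  by apply/funext => n /=; rewrite subrK.
by rewrite -[completion_abs_fun _]add0r; exact: cvgD.
Unshelve. all: by end_near. Qed.

Arguments completion_abs_cvg u : clear implicits.

Lemma completion_abs_ge0 X : 0 <= completion_abs_fun X.
Proof.
elim/quotW: X => u.
rewrite -(cvg_lim _ (completion_abs_cvg u)) //; apply: limr_ge.
  by apply/cvg_ex; eexists; exact: completion_abs_cvg.
by near=> n; exact: absval_ge0.
Unshelve. all: by end_near. Qed.

Lemma completion_abs_eq0 X : completion_abs_fun X = 0 -> X = 0.
Proof.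
elim/quotW: X => u u0; apply/completion_eq0P/null_sequence_cvg.
by rewrite -u0; exact: completion_abs_cvg.
Qed.

Lemma completion_abs0 : completion_abs_fun 0 = 0.
Proof.
rewrite -[X in completion_abs_fun X](rmorph0 \pi_(completion v)).
apply: (cvg_unique _ (completion_abs_cvg _)) => //.
exact/null_sequence_cvg/(completion_eq0P 0)/rmorph0.
Qed.

Lemma completion_absM X Y :
  completion_abs_fun (X * Y) = completion_abs_fun X * completion_abs_fun Y.
Proof.
elim/quotW: X => x; elim/quotW: Y => y.
rewrite -[X in completion_abs_fun X](rmorphM \pi_(completion v)).
apply: (cvg_unique _ (completion_abs_cvg _)) => //=.
under eq_fun do rewrite absvalM.
by apply: cvgM; exact: completion_abs_cvg.
Qed.

Lemma completion_absD X Y :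
  completion_abs_fun (X + Y) <= completion_abs_fun X + completion_abs_fun Y.
Proof.
elim/quotW: X => x; elim/quotW: Y => y.
rewrite -[X in completion_abs_fun X](rmorphD \pi_(completion v)).
apply: (ler_cvg_to (completion_abs_cvg _)
  (cvgD (completion_abs_cvg x) (completion_abs_cvg y))).
by near=> n; exact: absvalD.
Unshelve. all: by end_near. Qed.

Definition completion_abs : absval R (completion v) :=
  AbsVal completion_abs_ge0 completion_abs_eq0 completion_abs0
    completion_absM completion_absD.


Lemma cauchy_cst (x : F) : (fun=> x) \in cauchy_pred v.
Proof.
by apply/asboolP => e e0; exists 0%N => m n _ _; rewrite subrr absval0.
Qed.

Definition completion_emb (x : F) : completion v :=
  \pi_(completion v) (CauchySeq (cauchy_cst x)).

Lemma completion_emb_zmod : zmod_morphism completion_emb.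
Proof.
move=> x y; rewrite /completion_emb -[RHS](rmorphB \pi_(completion v)).
by congr (\pi _); exact: val_inj.
Qed.

Lemma completion_emb_monoid : monoid_morphism completion_emb.
Proof.
split=> [|x y]; rewrite /completion_emb.
  rewrite -[RHS](rmorph1 \pi_(completion v)).
  by congr (\pi _); exact: val_inj.
rewrite -[RHS](rmorphM \pi_(completion v)).
by congr (\pi _); exact: val_inj.
Qed.

HB.instance Definition _ :=
  GRing.isZmodMorphism.Build F (completion v) completion_emb completion_emb_zmod.
HB.instance Definition _ :=
  GRing.isMonoidMorphism.Build F (completion v) completion_emb
    completion_emb_monoid.

Lemma completion_abs_emb x : completion_abs (completion_emb x) = v x.
Proof.
apply: (cvg_unique _ (completion_abs_cvg _)) => //=.
exact: cvg_cst.
Qed.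

Lemma completion_emb_cvg (u : cauchy_seq v) :
  null_sequence completion_abs (fun n => \pi u - completion_emb (u n)).
Proof.
move=> e e0; have /asboolP cu := valP u.
have [N hN] := cu _ (divr_gt0 e0 (ltr0Sn R 1) : 0 < e / 2).
exists N => n Nn; apply: (@le_lt_trans _ _ (e / 2)); last by lra.
rewrite /completion_emb -[X in completion_abs X](rmorphB \pi_(completion v)).
rewrite -[leLHS](cvg_lim _ (completion_abs_cvg _)) //; apply: limr_le.
  by apply/cvg_ex; eexists; exact: completion_abs_cvg.
by exists N => // m Nm; rewrite ltW // hN.
Qed.

Lemma completion_dense (X : completion v) (e : R) : 0 < e ->
  exists x, completion_abs (X - completion_emb x) < e.
Proof.
elim/quotW: X => u e0; have [N hN] := completion_emb_cvg u e0.
by exists (u N); exact: hN.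
Qed.

Definition complete_absval (k : fieldType) (a : absval R k) :=
  forall u : nat -> k, cauchy_sequence a u ->
  exists l, null_sequence a (fun n => u n - l).

(** Replacing the [n]-th term by an element of [F] within [n.+1%:R^-1] of it gives a Cauchy sequence
    in [F], whose class is the limit. *)
Lemma completion_complete : complete_absval completion_abs.
Proof.
move=> U cU.
have ex n : exists x, completion_abs (U n - completion_emb x) < n.+1%:R^-1.
  by apply: completion_dense; rewrite invr_gt0.
have [u hu] := choice ex.
have cu : u \in cauchy_pred v.
  apply/asboolP => e e0.
  have e3 : 0 < e / 3 by lra.
  have [N1 h1] := cU _ e3; have [N2 h2] := invS_small e3.
  exists (maxn N1 N2) => m n; rewrite !geq_max => /andP[a b] /andP[c d].
  rewrite -completion_abs_emb rmorphB.
  have -> : completion_emb (u m) - completion_emb (u n) =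
    (U m - U n) + ((U n - completion_emb (u n)) - (U m - completion_emb (u m))).
    by ring.
  have := absvalD completion_abs (U m - U n)
    ((U n - completion_emb (u n)) - (U m - completion_emb (u m))).
  have := absvalB completion_abs (U n - completion_emb (u n))
    (U m - completion_emb (u m)).
  have := h1 _ _ a c; have := lt_trans (hu m) (h2 _ b).
  by have := lt_trans (hu n) (h2 _ d); lra.
exists (\pi_(completion v) (CauchySeq cu)) => e e0.
have e2 : 0 < e / 2 by lra.
have [N1 h1] := completion_emb_cvg (CauchySeq cu) e2.
have [N2 h2] := invS_small e2.
exists (maxn N1 N2) => n; rewrite geq_max => /andP[a b].
have -> : U n - \pi_(completion v) (CauchySeq cu) =
    (U n - completion_emb (u n)) -
    (\pi_(completion v) (CauchySeq cu) - completion_emb (u n)) by ring.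
have := absvalB completion_abs (U n - completion_emb (u n))
  (\pi_(completion v) (CauchySeq cu) - completion_emb (u n)).
have : completion_abs (\pi_(completion v) (CauchySeq cu) - completion_emb (u n))
  < e / 2 := h1 _ a.
by have := lt_trans (hu n) (h2 _ b); lra.
Qed.

End CompletionAbs.

Arguments completion_abs_cvg {R F v} u.

(** * Functoriality of the completion *)

Section CompletionMap.

Variables (R : realType) (F F' : fieldType) (v : absval R F) (v' : absval R F').
Variables (j : {rmorphism F -> F'}) (jv : forall x, v' (j x) = v x).

Lemma cauchy_map (u : cauchy_seq v) : (j \o u) \in cauchy_pred v'.
Proof.
have /asboolP cu := valP u; apply/asboolP => e e0.
have [N hN] := cu _ e0; exists N => m n Nm Nn.
by rewrite /= -rmorphB jv hN.
Qed.

(** Through this map the completion of [rat] becomes a common base field of the completions of [K]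
    and of [algC], which makes the two comparable. *)
Definition completion_map (X : completion v) : completion v' :=
  \pi_(completion v') (CauchySeq (cauchy_map (repr X))).

Lemma completion_mapE (u : cauchy_seq v) :
  completion_map (\pi u) = \pi_(completion v') (CauchySeq (cauchy_map u)).
Proof.
apply/completion_eqP => e e0.
have /completion_eqP/(_ e e0)[N hN] :
  \pi_(completion v) (repr (\pi_(completion v) u : completion v)) = \pi u.
  by rewrite reprK.
by exists N => n /hN; rewrite /= -rmorphB jv.
Qed.

Lemma completion_map_zmod : zmod_morphism completion_map.
Proof.
move=> X Y; elim/quotW: X => x; elim/quotW: Y => y.
rewrite -[X in completion_map X](rmorphB \pi_(completion v)) !completion_mapE.
rewrite -[RHS](rmorphB \pi_(completion v')).
by congr (\pi _); apply: val_inj; apply/funext => n; rewrite /= rmorphB.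
Qed.

Lemma completion_map_monoid : monoid_morphism completion_map.
Proof.
split=> [|X Y].
  rewrite -[X in completion_map X](rmorph1 \pi_(completion v)) completion_mapE.
  rewrite -[RHS](rmorph1 \pi_(completion v')).
  by congr (\pi _); apply: val_inj; apply/funext => n; rewrite /= rmorph1.
elim/quotW: X => x; elim/quotW: Y => y.
rewrite -[X in completion_map X](rmorphM \pi_(completion v)) !completion_mapE.
rewrite -[RHS](rmorphM \pi_(completion v')).
by congr (\pi _); apply: val_inj; apply/funext => n; rewrite /= rmorphM.
Qed.

HB.instance Definition _ :=
  GRing.isZmodMorphism.Build (completion v) (completion v') completion_map
    completion_map_zmod.
HB.instance Definition _ :=
  GRing.isMonoidMorphism.Build (completion v) (completion v') completion_map
    completion_map_monoid.

Lemma completion_map_emb x :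
  completion_map (completion_emb v x) = completion_emb v' (j x).
Proof. by rewrite completion_mapE; congr (\pi _); exact: val_inj. Qed.

Lemma completion_abs_map X : completion_abs v' (completion_map X) = completion_abs v X.
Proof.
elim/quotW: X => u; rewrite completion_mapE.
apply: (cvg_unique _ (completion_abs_cvg _)) => //=.
by under eq_fun do rewrite jv; exact: completion_abs_cvg.
Qed.

End CompletionMap.

(** * Uniqueness of extensions of a complete absolute value *)

Lemma bernoulli_le (R : realFieldType) (x : R) n :
  0 <= x -> 1 + n%:R * x <= (1 + x) ^+ n.
Proof.
move=> x0; elim: n => [|n IH]; first by rewrite mul0r addr0 expr0.
rewrite exprS -natr1 (le_trans _ (ler_wpM2l _ IH)) ?addr_ge0 //.
suff : 0 <= n%:R * (x * x) by nra.
by rewrite mulr_ge0 ?mulr_ge0.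
Qed.

Lemma expr_unbounded (R : realType) (t B : R) : 1 < t -> exists n, B < t ^+ n.
Proof.
move=> t1; have d0 : 0 < t - 1 by lra.
have := truncnS_gt (B / (t - 1)); rewrite ltr_pdivrMr //.
set n := (_.+1) => h; exists n.
by have := bernoulli_le n (ltW d0); rewrite subrKC; lra.
Qed.

(** The power trick: if [s < t], the powers of [t / s] outgrow any constant [C]. *)
Lemma le_of_expr_le (R : realType) (s t C : R) : 0 <= s -> 0 <= t ->
  (forall n, t ^+ n <= C * s ^+ n) -> t <= s.
Proof.
move=> s0 t0 h; rewrite leNgt; apply/negP => st.
have [s00|s00] := eqVneq s 0.
  by have := h 1%N; rewrite s00 expr1 mulr0; lra.
have sp : 0 < s by rewrite lt_neqAle eq_sym s00.
have ts : 1 < t / s by rewrite ltr_pdivlMr ?mul1r.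
have [n hn] := expr_unbounded C ts.
have := h n; rewrite -ler_pdivrMr ?exprn_gt0 // -expr_div_n leNgt hn //.
Qed.

Lemma absvalX (R : realType) (F : fieldType) (v : absval R F) x n :
  v (x ^+ n) = v x ^+ n.
Proof.
elim: n => [|n IH]; first by rewrite !expr0 absval1.
by rewrite !exprS absvalM IH.
Qed.

Lemma absval_sum (R : realType) (F : fieldType) (v : absval R F) I (r : seq I)
    (P : pred I) (f : I -> F) :
  v (\sum_(i <- r | P i) f i) <= \sum_(i <- r | P i) v (f i).
Proof.
elim/big_rec2: _ => [|i y z _ IH]; first by rewrite absval0.
by rewrite (le_trans (absvalD v _ _)) // lerD2l.
Qed.

Lemma absval_prod (R : realType) (F : fieldType) (v : absval R F) I (r : seq I)
    (P : pred I) (f : I -> F) :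
  v (\prod_(i <- r | P i) f i) = \prod_(i <- r | P i) v (f i).
Proof. by apply: big_morph; [exact: absvalM|exact: absval1]. Qed.

(** * Equivalence of norms over a complete field *)

Section NormEquivalence.

Variables (R : realType) (k : fieldType) (a : absval R k).
Variables (E : fieldType) (e : absval R E) (io : {rmorphism k -> E}).
Hypothesis ioe : forall c, e (io c) = a c.
Variable x : E.

Local Notation ev q := (map_poly io q).[x].

Lemma absval_horner_le m (q : {poly k}) : (size q <= m)%N ->
  e (ev q) <= \sum_(i < m) a q`_i * e x ^+ i.
Proof.
move=> qm; rewrite (@horner_coef_wide _ m) ?size_map_poly //.
rewrite (le_trans (absval_sum _ _ _ _)) //; apply: ler_sum => i _.
by rewrite absvalM absvalX coef_map /= ioe.
Qed.

(** Once coefficients are controlled by the value at [x], they form Cauchy sequences in the complete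
    field [k], and the polynomial of their limits gives the limit of the values. So polynomial
    values of bounded degree form a closed set. *)
Lemma coef_limit m (q : nat -> {poly k}) (C : R) :
    complete_absval a -> 0 < C ->
    (forall p : {poly k}, (size p <= m)%N -> forall i, a p`_i <= C * e (ev p)) ->
    (forall n, size (q n) <= m)%N -> cauchy_sequence e (fun n => ev (q n)) ->
  exists2 r : {poly k}, (size r <= m)%N &
    null_sequence e (fun n => ev (q n) - ev r).
Proof.
move=> ka C0 hC sq cq.
have cqi i : cauchy_sequence a (fun n => (q n)`_i).
  move=> d d0; have [N hN] := cq _ (divr_gt0 d0 C0).
  exists N => s t Ns Nt; rewrite -coefB; apply: (le_lt_trans (hC _ _ i)).
    by rewrite (leq_trans (size_polyD _ _)) // size_polyN geq_max !sq.
  by rewrite rmorphB hornerD hornerN mulrC -ltr_pdivlMr // hN.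
have [l hl] := choice (fun i => ka _ (cqi i)).
exists (\poly_(i < m) l i); first exact: size_poly.
set r := \poly_(i < m) l i => d d0.
pose B := \sum_(i < m) e x ^+ i + 1.
have B0 : 0 < B by rewrite ltr_wpDl // sumr_ge0 // => i _; rewrite exprn_ge0 ?absval_ge0.
have dB : 0 < d / 2 / B by rewrite !divr_gt0.
have [N2 h2] := choice (fun i => hl i _ dB).
exists (\max_(i < m) N2 i) => n Nn.
rewrite -hornerN -hornerD -rmorphB; apply: (@le_lt_trans _ _ (d / 2)); last by lra.
apply: (le_trans (@absval_horner_le m _ _)).
  by rewrite (leq_trans (size_polyD _ _)) // size_polyN geq_max sq size_poly.
apply: (@le_trans _ _ (\sum_(i < m) (d / 2 / B) * e x ^+ i)).
  apply: ler_sum => i _; rewrite ler_wpM2r ?exprn_ge0 ?absval_ge0 //.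
  rewrite coefB coef_poly ltn_ord ltW // h2 // (leq_trans _ Nn) //.
  exact: (@leq_bigmax _ (fun j : 'I_m => N2 j) i).
rewrite -mulr_sumr -mulrA ger_pMr ?divr_gt0 // mulrC ler_pdivrMr // mul1r.
by rewrite /B lerDl.
Qed.

(** Induction on the dimension. The values of the monic polynomials ['X^m + q] stay away from 0:
    otherwise [- x ^+ m] would be a limit of values of polynomials of smaller degree, hence one of
    them by [coef_limit], against injectivity. *)
Lemma coef_norm_equiv m : complete_absval a ->
    (forall q : {poly k}, (size q <= m)%N -> ev q = 0 -> q = 0) ->
  exists2 C : R, 0 < C & forall q : {poly k}, (size q <= m)%N ->
    forall i, a q`_i <= C * e (ev q).
Proof.
move=> ka; elim: m => [|m IH] inj.
  exists 1 => // q; rewrite leqn0 size_poly_eq0 => /eqP -> i.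
  by rewrite coef0 absval0 mul1r absval_ge0.
have [q qm|C C0 hC] := IH; first by apply: inj; rewrite (leq_trans qm).
have [c c0 hc] : exists2 c : R, 0 < c & forall q : {poly k}, (size q <= m)%N ->
    c <= e (ev ('X^m + q)).
  apply: contrapT => nc.
  have ex n : exists q : {poly k}, (size q <= m)%N /\
      e (ev ('X^m + q)) < n.+1%:R^-1.
    apply: contrapT => nq; apply: nc; exists n.+1%:R^-1; first by rewrite invr_gt0.
    move=> q qm; rewrite leNgt; apply/negP => lt; apply: nq; by exists q.
  have [q hq] := choice ex.
  have evD p : ev ('X^m + p) = x ^+ m + ev p.
    by rewrite rmorphD /= map_polyXn hornerD hornerXn.
  have cq : cauchy_sequence e (fun n => ev (q n)).
    move=> d d0; have d2 : 0 < d / 2 by lra.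
    have [N hN] := invS_small d2; exists N => s t Ns Nt.
    have -> : ev (q s) - ev (q t) = ev ('X^m + q s) - ev ('X^m + q t).
      by rewrite !evD; ring.
    rewrite (le_lt_trans (absvalB _ _ _)) // (splitr d) ltrD //.
      by rewrite (lt_trans (hq s).2) ?hN.
    by rewrite (lt_trans (hq t).2) ?hN.
  have [r rm hr] := coef_limit ka C0 hC (fun n => (hq n).1) cq.
  have r0 : ev ('X^m + r) = 0.
    apply: (absval_eq0 (a := e)); apply/eqP; rewrite eq_le absval_ge0 andbT.
    apply/ler_addgt0Pr => d d0; rewrite add0r.
    have d2 : 0 < d / 2 by lra.
    have [N1 h1] := invS_small d2; have [N2 h2] := hr _ d2.
    pose N := maxn N1 N2.
    have -> : ev ('X^m + r) = ev ('X^m + q N) - (ev (q N) - ev r).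
      by rewrite !evD; ring.
    rewrite (le_trans (absvalB _ _ _)) // (splitr d) lerD //.
      by rewrite ltW // (lt_trans (hq N).2) // h1 // leq_maxl.
    by rewrite ltW // h2 // leq_maxr.
  have : 'X^m + r = 0.
    apply: inj r0; rewrite (leq_trans (size_polyD _ _)) //.
    by rewrite size_polyXn geq_max leqnn ltnW.
  move=> /(congr1 (coefp m)) /eqP.
  by rewrite /= coefD coefXn eqxx nth_default // addr0 coef0 oner_eq0.
(* The first term bounds the top coefficient, the second the coefficients left after removing the
   top monomial, whose value is at most [e x ^+ m / c] times that of [q]. *)
pose C' := c^-1 + C * (1 + e x ^+ m / c).
have ex0 : 0 <= e x ^+ m by rewrite exprn_ge0 ?absval_ge0.
exists C'.
  rewrite /C' addr_gt0 ?invr_gt0 // mulr_gt0 // ltr_pwDl //.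
  by rewrite divr_ge0 // ltW.
move=> q qm; set t := q`_m; set r := q - t *: 'X^m.
have rm : (size r <= m)%N.
  apply/leq_sizeP => i mi; rewrite coefB coefZ coefXn.
  have [->|im] := eqVneq i m; first by rewrite mulr1 subrr.
  rewrite mulr0 subr0 nth_default // (leq_trans qm) //.
  by rewrite ltn_neqAle eq_sym im.
have qE : q = t *: 'X^m + r by rewrite /r subrKC.
have ht : a t <= c^-1 * e (ev q).
  have [t0|t0] := eqVneq t 0.
    by rewrite t0 absval0 mulr_ge0 ?invr_ge0 ?absval_ge0 // ltW.
  have -> : q = t *: ('X^m + t^-1 *: r).
    by rewrite scalerDr scalerA mulfV // scale1r -qE.
  rewrite map_polyZ hornerZ absvalM ioe mulrCA ler_peMr ?absval_ge0 //.
  rewrite mulrC ler_pdivlMr // mul1r hc // (leq_trans (size_scale_leq _ _)) //.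
have hr i : a r`_i <= C * (1 + e x ^+ m / c) * e (ev q).
  apply: (le_trans (hC _ rm i)); rewrite -mulrA ler_pM2l //.
  rewrite /r rmorphB /= map_polyZ map_polyXn !hornerE.
  rewrite (le_trans (absvalB _ _ _)) // absvalM absvalX ioe.
  rewrite mulrDl mul1r lerD2l mulrC -!mulrA ler_wpM2l //.
have eq0 : 0 <= e (ev q) by exact: absval_ge0.
move=> i; have [->|im] := eqVneq i m.
  rewrite -/t (le_trans ht) // ler_wpM2r // lerDl.
  by rewrite mulr_ge0 ?(ltW C0) // addr_ge0 // divr_ge0 ?(ltW c0).
have -> : q`_i = r`_i by rewrite coefB coefZ coefXn (negbTE im) mulr0 subr0.
by rewrite (le_trans (hr i)) // ler_wpM2r // lerDr invr_ge0 ltW.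
Qed.

(** This provides the injectivity hypothesis of [coef_norm_equiv] for the degree of [h]: a nonzero
    [q] of smaller degree is coprime to [h] and shares no root with it. *)
Lemma irreducible_minimal (h : {poly k}) : irreducible_poly h -> ev h = 0 ->
  forall q : {poly k}, (size q <= (size h).-1)%N -> ev q = 0 -> q = 0.
Proof.
move=> irr h0 q qh q0; apply/eqP; apply: contraT => qn0.
have hn0 : h != 0 by exact: irredp_neq0.
have /coprimep_root/(_ _) : coprimep (map_poly io h) (map_poly io q).
  rewrite coprimep_map irreducible_poly_coprime //.
  apply: contraTN qh => /(dvdp_leq qn0) le.
  by rewrite -ltnNge (leq_trans _ le) // prednK // lt0n size_poly_eq0.
by move=> /(_ x); rewrite rootE h0 eqxx q0 eqxx => /(_ isT).
Qed.

Lemma horner_modp (h q : {poly k}) : ev h = 0 -> ev (q %% h) = ev q.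
Proof.
move=> h0; rewrite [q in RHS](divp_eq q h) rmorphD rmorphM /=.
by rewrite hornerD hornerM h0 mulr0 add0r.
Qed.

End NormEquivalence.

Section UniqueExtension.

Variables (R : realType) (k : fieldType) (a : absval R k).
Hypothesis ka : complete_absval a.

(** Norm equivalence in [E1] and the triangle inequality in [E2] give the inequality up to a
    constant that does not depend on [q]. Applied to the powers of [q], it loses the constant. *)
Lemma absval_ext_le (E1 E2 : fieldType) (e1 : absval R E1) (e2 : absval R E2)
    (io1 : {rmorphism k -> E1}) (io2 : {rmorphism k -> E2}) x1 x2
    (h q : {poly k}) :
    (forall c, e1 (io1 c) = a c) -> (forall c, e2 (io2 c) = a c) ->
    irreducible_poly h ->
    (map_poly io1 h).[x1] = 0 -> (map_poly io2 h).[x2] = 0 ->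
  e2 (map_poly io2 q).[x2] <= e1 (map_poly io1 q).[x1].
Proof.
move=> ioe1 ioe2 irr h1 h2.
have [C C0 hC] := coef_norm_equiv ioe1 ka (irreducible_minimal irr h1).
pose n := (size h).-1.
(* Reduction modulo [h] changes neither value and makes the bound hold in every degree, in
   particular for all powers of [q]. *)
have {}hC (p : {poly k}) : e2 (map_poly io2 p).[x2] <=
    (\sum_(i < n) C * e2 x2 ^+ i) * e1 (map_poly io1 p).[x1].
  rewrite -[in leRHS](horner_modp p h1) -[in leLHS](horner_modp p h2).
  have sp : (size (p %% h)%R <= n)%N.
    have : (size (p %% h)%R < size h)%N by rewrite ltn_modp irredp_neq0.
    by rewrite /n; case: (size h).
  rewrite (le_trans (absval_horner_le ioe2 x2 sp)) // mulr_suml.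
  apply: ler_sum => i _; rewrite mulrAC ler_wpM2r ?exprn_ge0 ?absval_ge0 //.
  exact: hC.
apply: (@le_of_expr_le _ _ _ (\sum_(i < n) C * e2 x2 ^+ i)) => [||m];
  rewrite ?absval_ge0 //.
by rewrite -!absvalX -!horner_exp -!rmorphXn; exact: hC.
Qed.

Lemma absval_ext_unique (E1 E2 : fieldType) (e1 : absval R E1) (e2 : absval R E2)
    (io1 : {rmorphism k -> E1}) (io2 : {rmorphism k -> E2}) x1 x2
    (h q : {poly k}) :
    (forall c, e1 (io1 c) = a c) -> (forall c, e2 (io2 c) = a c) ->
    irreducible_poly h ->
    (map_poly io1 h).[x1] = 0 -> (map_poly io2 h).[x2] = 0 ->
  e1 (map_poly io1 q).[x1] = e2 (map_poly io2 q).[x2].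
Proof.
by move=> *; apply/eqP; rewrite eq_le; apply/andP; split; apply: absval_ext_le;
  eassumption.
Qed.

End UniqueExtension.

(** * Places of a number field and roots of a minimal polynomial *)

Section MinimalPolynomial.

Variables (k E : fieldType) (io : {rmorphism k -> E}) (x : E).

Lemma exists_irreducible_annihilator (p : {poly k}) : p != 0 ->
    (map_poly io p).[x] = 0 ->
  exists2 h : {poly k}, irreducible_poly h & (map_poly io h).[x] = 0.
Proof.
move=> p0 px.
pose P n := `[< exists h : {poly k}, [/\ h != 0, (map_poly io h).[x] = 0
  & size h = n] >].
have exP : exists n, P n by exists (size p); apply/asboolP; exists p.
have [n /asboolP[h [h0 hx hn]] nmin] := ex_minnP exP.
have {}nmin (q : {poly k}) : q != 0 -> (map_poly io q).[x] = 0 -> (size h <= size q)%N.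
  by move=> q0 qx; rewrite hn; apply: nmin; apply/asboolP; exists q.
exists h => //; split=> [|d d1 dh].
  rewrite ltnNge; apply: contra_neqN h0 => /size1_polyC hC.
  move: hx; rewrite hC map_polyC /= hornerC => /eqP.
  by rewrite fmorph_eq0 => /eqP ->.
have d0 : d != 0 by apply: dvdpN0 dh h0.
have /dvdpP[c hE] := dh.
have c0 : c != 0 by apply: contraNneq h0 => c0; rewrite hE c0 mul0r.
have : (map_poly io (c * d)).[x] == 0 by rewrite -hE hx.
rewrite rmorphM /= hornerM mulf_eq0.
case/orP => /eqP /nmin.
  move=> /(_ c0); rewrite hE size_mul // -subn1 leq_subLR addnC leq_add2r => sd.
  by move: d1; rewrite eqn_leq sd size_poly_gt0 d0.
move=> /(_ d0) hd; rewrite -dvdp_size_eqp //.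
by rewrite eqn_leq hd dvdp_leq ?h0.
Qed.

End MinimalPolynomial.

(** [local_degree] selects some [d] that admits a basis, so [d] must be shown unique. Passing from
    [b] to [b'] and back gives coordinates of [b i] in [b]; by uniqueness they are those of a unit
    vector, so the two transition matrices multiply to 1. *)
Lemma basis_over_dim_le (k L : fieldType) (io : {rmorphism k -> L}) d d'
    (b : 'I_d -> L) (b' : 'I_d' -> L) :
  is_basis_over (range io) b -> is_basis_over (range io) b' -> (d <= d')%N.
Proof.
have coords n (c : 'I_n -> L) : is_basis_over (range io) c ->
    forall y, exists g : 'I_n -> k, y = \sum_i io (g i) * c i.
  move=> hc y; have [g [[hg yE] _]] := hc y.
  have [g' hg'] := choice (fun i => (let: ex_intro2 z _ zE := hg i in
    ex_intro (fun z => io z = g i) z zE)).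
  by exists g'; rewrite yE; apply: eq_bigr => i _; rewrite hg'.
move=> hb hb'.
have [A hA] := choice (fun i => coords _ _ hb' (b i)).
have [B hB] := choice (fun j => coords _ _ hb (b' j)).
apply: (@mulmx1_min _ _ _ (\matrix_(i, j) A i j) (\matrix_(i, j) B i j)).
apply/matrixP => i l; rewrite !mxE.
pose c := [ffun l => io (\sum_j A i j * B j l)].
pose c' := [ffun l => io ((i == l)%:R)].
have [g [_ gu]] := hb (b i).
have cg : g = c.
  apply: gu; split=> [l'|]; first by rewrite ffunE; eexists.
  rewrite {1}(hA i).
  under eq_bigr => j _ do rewrite hB mulr_sumr.
  rewrite exchange_big; apply: eq_bigr => l' _ /=.
  rewrite ffunE rmorph_sum mulr_suml; apply: eq_bigr => j _.
  by rewrite rmorphM mulrA.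
have c'g : g = c'.
  apply: gu; split=> [l'|]; first by rewrite ffunE; eexists.
  rewrite (bigD1 i) //= ffunE eqxx rmorph1 mul1r big1 ?addr0 // => l' li.
  by rewrite ffunE eq_sym (negbTE li) rmorph0 mul0r.
have /ffunP/(_ l) : c = c' by rewrite -cg -c'g.
rewrite !ffunE => /fmorph_inj <-; apply: eq_bigr => j _.
by rewrite !mxE.
Qed.

Lemma rational_polyE (K : fieldExtType rat) (x : K) : <<1; x>>%VS = fullv ->
  forall z : K, exists q : {poly rat}, z = (map_poly (in_alg K) q).[x].
Proof.
move=> xfull z.
have : z \in <<1; x>>%VS by rewrite xfull memvf.
case/Fadjoin_polyP => p /polyOver1P[q ->] ->.
by exists q.
Qed.

(** * The local degree as the degree of an irreducible polynomial *)

Section LocalDegree.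

Variables (R : realType) (K : fieldExtType rat) (x : K).
Hypothesis xfull : <<1; x>>%VS = fullv.
Variables (v : place R K) (w0 : absval R rat).
Hypothesis vw0 : forall q : rat, v (in_alg K q) = w0 q.

Local Notation io := (completion_map vw0).
Local Notation xh := (completion_emb v x).
Local Notation a := (completion_abs w0).
Local Notation e := (completion_abs v).

Let ioe c : e (io c) = a c. Proof. exact: completion_abs_map. Qed.

(** Presents the copy of the completed rationals as the image of a complete field, to which norm
    equivalence applies. *)
Lemma rat_completionE : @rat_completion R K v = range io.
Proof.
apply/seteqP; split=> y.
  move=> [u [hu ->]]; have [q hq] := choice hu.
  have cq : q \in cauchy_pred w0.
    have /asboolP cu := valP u; apply/asboolP => d d0.
    have [N hN] := cu _ d0; exists N => m n Nm Nn.
    by rewrite -vw0 rmorphB /= -!hq; exact: hN.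
  exists (\pi_(completion w0) (CauchySeq cq)) => //.
  rewrite completion_mapE; congr (\pi_(completion v) _).
  by apply: val_inj; apply/funext => n; rewrite /= hq.
move=> [z _ <-]; elim/quotW: z => q; rewrite completion_mapE.
by eexists; split; [|reflexivity] => n; exists (q n).
Qed.

Lemma horner_completion_rat (q : {poly rat}) :
  (map_poly io (map_poly (completion_emb w0) q)).[xh] =
  completion_emb v (map_poly (in_alg K) q).[x].
Proof.
rewrite -horner_map -!map_poly_comp; congr (_.[_]).
by apply: eq_map_poly => c /=; rewrite completion_map_emb.
Qed.

Variable h : {poly completion w0}.
Hypothesis irr : irreducible_poly h.
Hypothesis hx : (map_poly io h).[xh] = 0.

(** [K] is dense and consists of polynomials in [x], which may be reduced modulo [h]; by
    [coef_limit] the values of such reduced polynomials are closed under limits. *)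
Lemma completion_spanned (y : completion v) : exists2 q : {poly completion w0},
  (size q <= (size h).-1)%N & y = (map_poly io q).[xh].
Proof.
elim/quotW: y => u.
have [p hp] := choice (fun n => rational_polyE xfull (u n)).
pose s n := map_poly (completion_emb w0) (p n) %% h.
have ss n : (size (s n) <= (size h).-1)%N.
  have : (size (s n) < size h)%N by rewrite ltn_modp irredp_neq0.
  by case: (size h).
have evs n : (map_poly io (s n)).[xh] = completion_emb v (u n).
  by rewrite /s horner_modp // horner_completion_rat -hp.
have [C C0 hC] := coef_norm_equiv ioe (completion_complete (v := w0))
  (irreducible_minimal irr hx).
have cs : cauchy_sequence e (fun n => (map_poly io (s n)).[xh]).
  move=> d d0; have /asboolP cu := valP u.
  have [N hN] := cu _ d0; exists N => m n Nm Nn.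
  by rewrite !evs -rmorphB completion_abs_emb hN.
have [r sr hr] := coef_limit ioe (completion_complete (v := w0)) C0 hC ss cs.
exists r => //; apply/eqP; rewrite -subr_eq0; apply/eqP.
apply: (absval_eq0 (a := e)); apply/eqP; rewrite eq_le absval_ge0 andbT.
apply/ler_addgt0Pr => d d0; rewrite add0r.
have d2 : 0 < d / 2 by lra.
have [N1 h1] := completion_emb_cvg u d2; have [N2 h2] := hr _ d2.
pose N := maxn N1 N2.
rewrite -[X in e X](subrKA (completion_emb v (u N))) (le_trans (absvalD _ _ _)) //.
rewrite (splitr d) lerD // ltW ?h1 ?leq_maxl // -evs h2 // leq_maxr //.
Qed.

Lemma local_degreeE : local_degree v = (size h).-1.
Proof.
set n := (size h).-1.
have minh := irreducible_minimal irr hx.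
have evE (c : 'I_n -> completion w0) :
    \sum_i io (c i) * xh ^+ i =
    (map_poly io (\poly_(i < n) (if insub i is Some j then c j else 0))).[xh].
  rewrite (@horner_coef_wide _ n) ?size_map_poly ?size_poly //.
  apply: eq_bigr => i _; rewrite coef_map coef_poly ltn_ord.
  by rewrite valK.
have basis : is_basis_over (@rat_completion R K v) (fun i : 'I_n => xh ^+ i).
  rewrite rat_completionE => y; have [q sq yE] := completion_spanned y.
  exists [ffun i : 'I_n => io q`_i]; split.
    split=> [i|]; first by rewrite ffunE; eexists.
    rewrite yE (@horner_coef_wide _ n) ?size_map_poly //.
    by apply: eq_bigr => i _; rewrite ffunE coef_map.
  move=> c [hc yc]; have [g hg] := choice (fun i => (let: ex_intro2 z _ zE := hc i in
    ex_intro (fun z => io z = c i) z zE)).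
  set p := \poly_(i < n) (if insub i is Some j then g j else 0).
  have pq : q - p = 0.
    apply: minh.
      by rewrite (leq_trans (size_polyD _ _)) // size_polyN geq_max sq size_poly.
    rewrite rmorphB hornerD hornerN -yE -evE yc; apply/eqP; rewrite subr_eq0.
    by apply/eqP/eq_bigr => i _; rewrite hg.
  apply/ffunP => i; rewrite ffunE (subr0_eq pq) coef_poly ltn_ord valK.
  exact: hg.
rewrite /local_degree; case: xgetP => [d _ [b hb]|/(_ n)]; last first.
  by move=> []; exists (fun i : 'I_n => xh ^+ i).
move: basis hb; rewrite rat_completionE => basis hb.
by apply/eqP; rewrite eqn_leq (basis_over_dim_le hb basis) (basis_over_dim_le basis hb).
Qed.

End LocalDegree.

Lemma map_prod_XsubC (F F' : fieldType) (j : {rmorphism F -> F'}) (r : seq F) :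
  map_poly j (\prod_(c <- r) ('X - c%:P)) = \prod_(c <- map j r) ('X - c%:P).
Proof.
by rewrite rmorph_prod big_map; apply: eq_bigr => c _; rewrite /= map_polyXsubC.
Qed.

Lemma absval_inj (R : realType) (F : fieldType) (v v' : absval R F) :
  v =1 v' -> v = v'.
Proof.
case: v v' => [f1 ? ? ? ? ?] [f2 ? ? ? ? ?] /= /funext e.
by subst f2; congr AbsVal; exact: Prop_irrelevance.
Qed.

Definition absval_comp (R : realType) (F F' : fieldType) (v : absval R F')
    (j : {rmorphism F -> F'}) : absval R F.
Proof.
apply: (@AbsVal _ _ (v \o j)) => [x||||] /=.
- exact: absval_ge0.
- by move=> x /absval_eq0 /eqP; rewrite fmorph_eq0 => /eqP.
- by rewrite rmorph0 absval0.
- by move=> x y; rewrite rmorphM absvalM.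
- by move=> x y; rewrite rmorphD absvalD.
Defined.

(* [f] is the minimal polynomial of [x] over [rat], split over [algC]. *)
Section PlacesAndRoots.

Variables (R : realType) (K : fieldExtType rat) (x : K).
Hypothesis xfull : <<1; x>>%VS = fullv.
Variables (f : {poly rat}) (s : seq algC).
Hypothesis fx : forall q : {poly rat}, (f %| q) = ((map_poly (in_alg K) q).[x] == 0).
Hypothesis fs : map_poly ratr f = \prod_(y <- s) ('X - y%:P) :> {poly algC}.
Hypothesis us : uniq s.

Lemma root_embedding y : y \in s -> exists sigma : {rmorphism K -> algC},
  forall q : {poly rat}, sigma (map_poly (in_alg K) q).[x] = (map_poly ratr q).[y].
Proof.
move=> ys.
have wd (q q' : {poly rat}) :
    (map_poly (in_alg K) q).[x] = (map_poly (in_alg K) q').[x] ->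
    (map_poly ratr q).[y] = (map_poly ratr q').[y] :> algC.
  move=> /eqP; rewrite -subr_eq0 -hornerN -hornerD -rmorphB -fx.
  move=> /dvdpP[c] /(congr1 (fun p => (map_poly ratr p : {poly algC}).[y])).
  rewrite rmorphB hornerD hornerN rmorphM /= hornerM fs.
  have /eqP -> : root (\prod_(z <- s) ('X - z%:P)) y by rewrite root_prod_XsubC.
  by rewrite mulr0 => /subr0_eq.
have [P hP] := choice (rational_polyE xfull).
pose sg z : algC := (map_poly ratr (P z)).[y].
have sgE q : sg (map_poly (in_alg K) q).[x] = (map_poly ratr q).[y].
  by apply: wd; rewrite -hP.
have sgB : zmod_morphism sg.
  move=> z z'; rewrite /sg -hornerN -hornerD -rmorphB; apply: wd.
  by rewrite -hP rmorphB hornerD hornerN -!hP.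
have sgM : monoid_morphism sg.
  split=> [|z z'].
    have -> : 1 = (map_poly ratr (1 : {poly rat})).[y] :> algC.
      by rewrite rmorph1 hornerC.
    by apply: wd; rewrite -hP rmorph1 hornerC.
  rewrite /sg -hornerM -rmorphM; apply: wd.
  by rewrite -hP rmorphM hornerM -!hP.
pose sgz := GRing.isZmodMorphism.Build K algC sg sgB.
pose sgm := GRing.isMonoidMorphism.Build K algC sg sgM.
pose sigma : {rmorphism K -> algC} := HB.pack sg sgz sgm.
by exists sigma.
Qed.

Variable w : absval R algC.
Let w0 : absval R rat := absval_comp w (ratr : {rmorphism rat -> algC}).

(** Says that [v] is [w] pulled back along the embedding of [K] sending [x] to [y]; the form with
    polynomials avoids naming that embedding. *)
Definition induces (v : K -> R) (y : algC) := forall q : {poly rat},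
  v (map_poly (in_alg K) q).[x] = w (map_poly ratr q).[y].

(** Over the completed rationals let [h] be the irreducible factor of [f] that vanishes at [x] in
    the completion of [K]. Its degree is the local degree, and the conjugates that are roots of [h]
    are exactly those inducing [v]. Positivity shows later that every place is induced by some
    conjugate. *)
Lemma induces_count (v : place R K) : (forall q : rat, v q%:A = w (ratr q)) ->
  local_degree v = count (fun y => `[< induces v y >]) s /\
  (0 < local_degree v)%N.
Proof.
move=> vw.
have vw0 : forall q : rat, v (in_alg K q) = w0 q by move=> q; exact: vw.
have ww0 : forall q : rat, w (ratr q) = w0 q by [].
pose io := completion_map vw0; pose iow := completion_map ww0.
pose xh := completion_emb v x.
pose fh := map_poly (completion_emb w0) f.
have f0 : f != 0.
  apply/eqP => f0; have := fs; rewrite f0 rmorph0 => /esym/eqP.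
  by rewrite (negbTE (monic_neq0 (monic_prod_XsubC _ _ _))).
have fhx : (map_poly io fh).[xh] = 0.
  rewrite horner_completion_rat; apply/eqP; rewrite fmorph_eq0 -fx //.
have [|h irr hx] := exists_irreducible_annihilator _ fhx.
  by rewrite map_poly_eq0.
have hf : h %| fh.
  apply/eqP; apply: (irreducible_minimal irr hx); last by rewrite horner_modp.
  have : (size (fh %% h)%R < size h)%N by rewrite ltn_modp irredp_neq0.
  by case: (size h).
pose zs := map (completion_emb w) s.
have uz : uniq zs by rewrite map_inj_uniq //; exact: fmorph_inj.
have fhw : map_poly iow fh = \prod_(z <- zs) ('X - z%:P).
  rewrite -map_poly_comp (@eq_map_poly _ _ _ (completion_emb w \o ratr)); last first.
    by move=> c /=; rewrite completion_map_emb.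
  by rewrite map_poly_comp fs map_prod_XsubC.
(* A divisor of a product of distinct linear factors is, up to a constant, a product of some of
   them, so the degree of [h] counts its roots among [zs]. *)
have : map_poly iow h %| \prod_(z <- zs) ('X - z%:P) by rewrite -fhw dvdp_map.
case/dvdp_prod_XsubC => m hm.
have cnt : (size h).-1 = count (root (map_poly iow h)) zs.
  rewrite -(size_map_poly iow) (eqp_size hm) size_prod_XsubC /=.
  have sm : subseq (mask m zs) zs by exact: mask_subseq.
  rewrite [mask m zs in LHS](elimT (subseq_uniqP uz) sm) size_filter.
  by apply: eq_count => z /=; rewrite (eqp_root hm) root_prod_XsubC.
rewrite (local_degreeE xfull irr hx) cnt count_map; split; last first.
  have [h1 _] := irr; rewrite -(count_map (completion_emb w)) -cnt.
  by case: (size h) h1 => [|[]].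
apply: eq_in_count => y ys /=; rewrite rootE; apply/eqP/asboolP => [hy q|ind].
  have := absval_ext_unique (completion_complete (v := w0))
    (map_poly (completion_emb w0) q)
    (completion_abs_map vw0) (completion_abs_map ww0) irr hx hy.
  rewrite horner_completion_rat completion_abs_emb => ->.
  rewrite -(completion_abs_emb w) -horner_map -!map_poly_comp.
  congr (completion_abs _ _.[_]).
  by apply: eq_map_poly => c /=; rewrite completion_map_emb.
(* Conversely, an inducing [y] gives an isometric embedding of [K] into [algC]; it extends to the
   completions and carries the root [xh] of [h] to [y]. *)
have [sg hsg] := root_embedding ys.
have vsg z : w (sg z) = v z.
  by have [q ->] := rational_polyE xfull z; rewrite hsg ind.
have := congr1 (completion_map vsg) hx; rewrite rmorph0 -horner_map /=.
have -> : completion_map vsg xh = completion_emb w y.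
  rewrite completion_map_emb; congr (completion_emb w _).
  by have := hsg 'X; rewrite !map_polyX !hornerX.
move=> <-; rewrite -map_poly_comp; congr (_.[_]); apply: eq_map_poly => c /=.
elim/quotW: c => u.
rewrite /iow (completion_mapE vw0) (completion_mapE vsg) (completion_mapE ww0).
congr (\pi_(completion w) _).
apply: val_inj; apply/funext => n /=.
by rewrite -in_algE -(fmorph_rat sg); congr (sg _); rewrite fmorph_eq_rat.
Qed.

Lemma place_of_root y : y \in s ->
    (forall q : rat, w (ratr q) = `|ratr q|) \/
    (exists2 p, prime p & forall q : rat, w (ratr q) = padic_abs R p q) ->
  exists v : place R K, induces v y.
Proof.
move=> ys hw; have [sg hsg] := root_embedding ys.
have E (q : rat) : absval_comp w sg q%:A = w (ratr q).
  rewrite /= -[in RHS](fmorph_rat sg); congr (w (sg _)).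
  by rewrite -in_algE fmorph_eq_rat.
have hv : (forall q : rat, absval_comp w sg q%:A = `|ratr q|) \/
    (exists2 p, prime p & forall q : rat, absval_comp w sg q%:A = padic_abs R p q).
  by case: hw => [hw|[p pp hw]]; [left|right; exists p] => // q; rewrite E.
by exists (Place hv) => q /=; rewrite hsg.
Qed.

Lemma induces_eq (v v' : place R K) y : induces v y -> induces v' y -> v = v'.
Proof.
move=> hv hv'.
have e : v =1 v'.
  by move=> z; have [q ->] := rational_polyE xfull z; rewrite hv hv'.
case: v v' e {hv hv'} => [v1 h1] [v2 h2] /= /absval_inj e.
by subst v2; congr Place; exact: Prop_irrelevance.
Qed.

End PlacesAndRoots.

(** * The archimedean absolute value of algC *)

Section ArchimedeanEmbedding.

Variables (R : realType) (F : archiRealFieldType).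

(** The embedding of an archimedean field into the reals by Dedekind cuts. It is needed because the
    modulus on [algC] takes values in [algC] and not in [R]. *)
Definition real_embedding (x : F) : R :=
  sup [set ratr q | q in [set q : rat | ratr q <= x]].

Local Notation phi := real_embedding.

Lemma ge_real_embedding x q : x <= ratr q -> phi x <= ratr q.
Proof.
move=> xq; apply: ge_sup.
  have [r] : exists r : rat, ratr r \in `]x - 1, x[.
    by apply: rat_in_itvoo; rewrite ltrBlDr ltrDl.
  by rewrite in_itv /= => /andP[_ rx]; exists (ratr r); exists r => //; exact: ltW.
by move=> _ [r /= rx <-]; rewrite ler_rat -(ler_rat F) (le_trans rx).
Qed.

Lemma le_real_embedding x q : ratr q <= x -> ratr q <= phi x.
Proof.
move=> qx; apply: ub_le_sup; last by exists q.
have [r] : exists r : rat, ratr r \in `]x, x + 1[.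
  by apply: rat_in_itvoo; rewrite ltrDl.
rewrite in_itv /= => /andP[xr _]; exists (ratr r) => _ [s /= sx <-].
by rewrite ler_rat -(ler_rat F) (le_trans sx) // ltW.
Qed.

Lemma lt_real_embedding x q : phi x < ratr q -> x <= ratr q.
Proof. by apply: contraTT; rewrite -!ltNge -leNgt => /ltW /le_real_embedding. Qed.

Lemma gt_real_embedding x q : ratr q < phi x -> ratr q <= x.
Proof. by apply: contraTT; rewrite -!ltNge -leNgt => /ltW /ge_real_embedding. Qed.

Lemma real_embedding_rat q : phi (ratr q) = ratr q.
Proof. by apply/eqP; rewrite eq_le ge_real_embedding ?le_real_embedding. Qed.

Lemma real_embedding_ge0 x : 0 <= x -> 0 <= phi x.
Proof.
by move=> x0; rewrite -(rmorph0 ratr); apply: le_real_embedding; rewrite rmorph0.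
Qed.

Lemma real_embedding_gt0 x : 0 < x -> 0 < phi x.
Proof.
move=> /rat_in_itvoo[q]; rewrite in_itv /= => /andP[q0 qx].
apply: lt_le_trans (le_real_embedding (ltW qx)).
by rewrite ltr0q -(ltr0q F).
Qed.

Lemma real_embedding_mono x y : x <= y -> phi x <= phi y.
Proof.
move=> xy; rewrite leNgt; apply/negP => /rat_in_itvoo[q].
rewrite in_itv /= => /andP[/lt_real_embedding yq]; rewrite ltNge => /negP; apply.
by apply: ge_real_embedding; exact: le_trans xy yq.
Qed.

Lemma real_embeddingD x y : phi (x + y) <= phi x + phi y.
Proof.
apply/ler_addgt0Pr => e e0.
have [q] : exists q : rat, ratr q \in `]phi x, phi x + e / 2[.
  by apply: rat_in_itvoo; rewrite ltrDl divr_gt0.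
have [r] : exists r : rat, ratr r \in `]phi y, phi y + e / 2[.
  by apply: rat_in_itvoo; rewrite ltrDl divr_gt0.
rewrite !in_itv /= => /andP[/lt_real_embedding yr re] /andP[/lt_real_embedding xq qe].
have : phi (x + y) <= ratr (q + r).
  by apply: ge_real_embedding; rewrite rmorphD lerD.
by rewrite rmorphD /=; lra.
Qed.

Lemma real_embeddingM_le x y : 0 <= x -> 0 <= y -> phi (x * y) <= phi x * phi y.
Proof.
move=> x0 y0; rewrite leNgt; apply/negP => lt.
have sx := real_embedding_ge0 x0; have sy := real_embedding_ge0 y0.
(* Since [d <= 1], the product of [phi x + d] and [phi y + d] is at most
   [phi x * phi y + d * (phi x + phi y + 1)], which the second bound on [d] keeps below
   [phi (x * y)]. *)
pose d := Num.min 1 ((phi (x * y) - phi x * phi y) / (phi x + phi y + 1)).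
have den : 0 < phi x + phi y + 1 by lra.
have d0 : 0 < d by rewrite lt_min ltr01 divr_gt0 // subr_gt0.
have d1 : d <= 1 by rewrite ge_min lexx.
have d2 : d * (phi x + phi y + 1) <= phi (x * y) - phi x * phi y.
  by rewrite -ler_pdivlMr // ge_min lexx orbT.
have [q] : exists q : rat, ratr q \in `]phi x, phi x + d[.
  by apply: rat_in_itvoo; rewrite ltrDl.
have [r] : exists r : rat, ratr r \in `]phi y, phi y + d[.
  by apply: rat_in_itvoo; rewrite ltrDl.
rewrite !in_itv /= => /andP[ry re] /andP[rx qe].
have : phi (x * y) <= ratr (q * r).
  apply: ge_real_embedding; rewrite rmorphM.
  by apply: ler_pM => //; exact: lt_real_embedding.
rewrite rmorphM /=; apply/negP; rewrite -ltNge.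
apply: (@lt_le_trans _ _ ((phi x + d) * (phi y + d))).
  by apply: ltr_pM => //; lra.
have : d * d <= d * 1 by rewrite ler_pM2l.
by nra.
Qed.

Lemma real_embeddingV x : 0 < x -> phi x^-1 <= (phi x)^-1.
Proof.
move=> x0; have px := real_embedding_gt0 x0.
have pV : 0 < phi x^-1 by apply: real_embedding_gt0; rewrite invr_gt0.
rewrite -[leLHS]invrK lef_pV2 ?posrE ?invr_gt0 // leNgt; apply/negP.
move=> /rat_in_itvoo[q]; rewrite in_itv /= => /andP[qV /gt_real_embedding qx].
have q0 : 0 < ratr q :> R by apply: lt_trans qV; rewrite invr_gt0.
have : phi x^-1 <= ratr q^-1.
  apply: ge_real_embedding; rewrite fmorphV lef_pV2 ?posrE //.
  by rewrite ltr0q -(ltr0q R).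
by rewrite fmorphV leNgt -[ltRHS]invrK ltf_pV2 ?posrE ?invr_gt0 // qV.
Qed.

(** The missing inequality is submultiplicativity applied to [x = x * y / y]. *)
Lemma real_embeddingM x y : 0 <= x -> 0 <= y -> phi (x * y) = phi x * phi y.
Proof.
move=> x0 y0; apply/eqP; rewrite eq_le real_embeddingM_le //=.
have phi0 : phi 0 = 0 by rewrite -(rmorph0 ratr) real_embedding_rat rmorph0.
have [->|y00] := eqVneq y 0; first by rewrite !(mulr0, phi0).
have {y00}y0 : 0 < y by rewrite lt_neqAle eq_sym y00.
have py := real_embedding_gt0 y0.
rewrite -ler_pdivlMr // -{1}[x](mulfK (lt0r_neq0 y0)).
have xy0 : 0 <= x * y by rewrite mulr_ge0 // ltW.
have yV0 : 0 <= y^-1 by rewrite invr_ge0 ltW.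
apply: (le_trans (real_embeddingM_le xy0 yV0)).
by rewrite ler_wpM2l ?real_embeddingV ?real_embedding_ge0.
Qed.

End ArchimedeanEmbedding.

Section ComplexAbs.

Variable R : realType.

Definition norm_algR (z : algC) : algR := in_algR (normr_real z).

Lemma norm_algR_ge0 z : 0 <= norm_algR z.
Proof. exact: (normr_ge0 z). Qed.

Lemma norm_algRM y z : norm_algR (y * z) = norm_algR y * norm_algR z.
Proof. by apply: val_inj; rewrite /= normrM. Qed.

Definition complex_abs_fun (z : algC) : R := real_embedding R (norm_algR z).

Lemma complex_abs_ge0 z : 0 <= complex_abs_fun z.
Proof. by apply: real_embedding_ge0; exact: norm_algR_ge0. Qed.

Lemma complex_abs_eq0 z : complex_abs_fun z = 0 -> z = 0.
Proof.
apply: contra_eq => z0; rewrite gt_eqF //; apply: real_embedding_gt0.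
by rewrite -[_ < _]/(0 < `|z|) normr_gt0.
Qed.

Lemma complex_abs_rat q : complex_abs_fun (ratr q) = `|ratr q|.
Proof.
rewrite -ratr_norm -(real_embedding_rat R algR); congr real_embedding.
apply: val_inj; rewrite /= -ratr_norm.
by rewrite -(fmorph_rat (algRval : {rmorphism algR -> algC})).
Qed.

Lemma complex_abs0 : complex_abs_fun 0 = 0.
Proof. by rewrite -(rmorph0 ratr) complex_abs_rat rmorph0 normr0. Qed.

Lemma complex_absM y z :
  complex_abs_fun (y * z) = complex_abs_fun y * complex_abs_fun z.
Proof.
by rewrite /complex_abs_fun norm_algRM real_embeddingM ?norm_algR_ge0.
Qed.

Lemma complex_absD y z :
  complex_abs_fun (y + z) <= complex_abs_fun y + complex_abs_fun z.
Proof.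
apply: le_trans (real_embeddingD _ _ _); apply: real_embedding_mono.
exact: (ler_normD y z).
Qed.

Definition complex_abs : absval R algC :=
  AbsVal complex_abs_ge0 complex_abs_eq0 complex_abs0 complex_absM complex_absD.

End ComplexAbs.

(** * Extension of the p-adic absolute value to algC *)

Section PadicExtension.

Variables (R : realType) (p : nat).
Hypothesis pp : prime p.

Let pi : algC := p%:R.

Let pi0 : pi != 0. Proof. by rewrite pnatr_eq0 -lt0n prime_gt0. Qed.

(* A maximal subring of [algC] in which [p] is not invertible is a valuation ring,
   and its valuation extends the [p]-adic one because [algC] is algebraic over
   [rat]. *)
Definition noninverting (A : set algC) :=
  [/\ A 1, (forall x y, A x -> A y -> A (x - y)),
      (forall x y, A x -> A y -> A (x * y)) & ~ A pi^-1].

Lemma noninverting_int : noninverting (range (intr : int -> algC)).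
Proof.
split; first by exists 1.
- by move=> _ _ [m _ <-] [n _ <-]; exists (m - n) => //; rewrite rmorphB.
- by move=> _ _ [m _ <-] [n _ <-]; exists (m * n) => //; rewrite rmorphM.
- move=> [n _ hn].
  have : (n * p%:Z)%:~R = 1 :> algC by rewrite rmorphM /= hn mulVf.
  rewrite -[1]/(1%:~R) => /intr_inj /(congr1 absz); rewrite abszM /= => /eqP.
  by rewrite muln_eq1 => /andP[_ /eqP p1]; have := pp; rewrite p1.
Qed.

Lemma maximal_noninverting : exists A, noninverting A /\
  forall B, A `<=` B -> noninverting B -> B `<=` A.
Proof.
have [F FP Ftot|A [hA maxA]] :=
    @Zorn_bigcup algC [set A | (exists x, A x) -> noninverting A].
  move=> [x0 [X0 FX0 X0x0]].
  have g0 : noninverting X0 by apply: FP => //; exists x0.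
  have two x y : (\bigcup_(X in F) X) x -> (\bigcup_(X in F) X) y ->
      exists X, [/\ F X, noninverting X, X x & X y].
    move=> [X FX Xx] [Y FY Yy].
    case: (Ftot _ _ FX FY) => h.
      by exists Y; split=> //; [apply: FP => //; exists y|exact: h].
    by exists X; split=> //; [apply: FP => //; exists x|exact: h].
  split; first by exists X0 => //; case: g0.
  - move=> x y hx hy; have [X [FX gX Xx Xy]] := two _ _ hx hy.
    by exists X => //; case: gX => _ + _ _; exact.
  - move=> x y hx hy; have [X [FX gX Xx Xy]] := two _ _ hx hy.
    by exists X => //; case: gX => _ _ + _; exact.
  - by move=> h; have [X [_ [_ _ _ nX] Xp _]] := two _ _ h h.
have A1 : exists x, A x.
  apply: contrapT => /forallNP nA.
  have /maxA : A `<` range (intr : int -> algC).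
    split=> [x /nA //|h]; apply: (nA 1); apply: h.
    by exists 1.
  by apply=> _; exact: noninverting_int.
exists A; split=> [|B AB gB]; first exact: hA.
by apply: contrapT => nBA; exact: (maxA B).
Qed.

Variable A : set algC.
Hypothesis gA : noninverting A.
Hypothesis maxA : forall B, A `<=` B -> noninverting B -> B `<=` A.

Let A1 : A 1. Proof. by case: gA. Qed.
Let AB x y : A x -> A y -> A (x - y).
Proof. by case: gA => _ h _ _; exact: h. Qed.
Let AM x y : A x -> A y -> A (x * y).
Proof. by case: gA => _ _ h _; exact: h. Qed.
Let ApV : ~ A pi^-1. Proof. by case: gA. Qed.
Let A0 : A 0. Proof. by rewrite -(subrr 1); apply: AB. Qed.
Let AN x : A x -> A (- x). Proof. by rewrite -sub0r; apply: AB. Qed.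
Let AD x y : A x -> A y -> A (x + y).
Proof. by move=> ? ?; rewrite -[y]opprK; apply: AB => //; exact: AN. Qed.
Let AX x n : A x -> A (x ^+ n).
Proof. by move=> Ax; elim: n => [|n IH]; rewrite ?expr0 ?exprS //; exact: AM. Qed.
Let An n : A n%:R.
Proof. by elim: n => // n IH; rewrite -natr1; exact: AD. Qed.
Let Az (n : int) : A n%:~R.
Proof. by case: n => n; rewrite ?NegzE ?rmorphN; [exact: An|apply: AN; exact: An]. Qed.
Let Asum I (r : seq I) (P : pred I) (f : I -> algC) :
  (forall i, P i -> A (f i)) -> A (\sum_(i <- r | P i) f i).
Proof. by move=> h; elim/big_ind: _. Qed.

(** By maximality the larger ring [A[x]] contains [pi^-1]. *)
Lemma overring_inverts x : ~ A x -> exists q : {poly algC},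
  (forall i, A q`_i) /\ pi * q.[x] = 1.
Proof.
move=> nAx; apply: contrapT => nq.
pose B := [set z | exists q : {poly algC}, (forall i, A q`_i) /\ z = q.[x]].
have AsubB : A `<=` B.
  move=> z Az'; exists z%:P; split; last by rewrite hornerC.
  by move=> i; rewrite coefC; case: ifP.
apply: nAx; apply: (maxA AsubB); last first.
  by exists 'X; split=> [i|]; rewrite ?hornerX // coefX; exact: An.
split; first exact: AsubB.
- move=> _ _ [q [hq ->]] [r [hr ->]]; exists (q - r).
  by split=> [i|]; rewrite ?coefB ?hornerD ?hornerN //; exact: AB.
- move=> _ _ [q [hq ->]] [r [hr ->]]; exists (q * r).
  split=> [i|]; rewrite ?coefM ?hornerM //.
  by apply: Asum => j _; exact: AM.
- move=> [q [hq qx]]; apply: nq; exists q; split=> //.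
  by rewrite -qx mulfV.
Qed.

(** Otherwise [pi^-1] is a polynomial in [u^-1] over [A]. Multiplying by [u ^+ n], which is 1 modulo
    [pi], clears the denominators and puts [pi^-1] into [A]. *)
Lemma one_sub_unit a : A a -> A (1 - pi * a)^-1.
Proof.
move=> Aa; set u := 1 - pi * a; apply: contrapT => /overring_inverts[q [hq qu]].
have u0 : u != 0.
  apply: contra_notN ApV => /eqP; rewrite /u => /subr0_eq h.
  by rewrite -[pi^-1]mulr1 h mulKf.
have Au : A u by apply: AB => //; apply: AM => //; exact: An.
pose n := size q.
have un : exists2 c, A c & u ^+ n = 1 - pi * c.
  elim: n => [|m [c Ac IH]]; first by exists 0 => //; rewrite mulr0 subr0.
  exists (c + u ^+ m * a); first by apply: AD => //; apply: AM => //; exact: AX.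
  by rewrite exprSr {2}/u mulrBr mulr1 IH; ring.
have [c Ac cE] := un.
have uq : A (u ^+ n * q.[u^-1]).
  rewrite horner_coef mulr_sumr; apply: Asum => i _; rewrite mulrCA.
  apply: AM => //; rewrite exprVn -expfB_cond; first exact: AX.
  by rewrite (negbTE u0) add0n ltnW.
apply: ApV; have -> : pi^-1 = u ^+ n * q.[u^-1] + c; last exact: AD.
apply: (mulfI pi0); rewrite mulfV // mulrDr mulrCA qu mulr1 cE.
by rewrite subrK.
Qed.

(** The constant term is moved to the right-hand side, which becomes a unit of the form [1 - pi * a]
    and is divided out; the remaining terms are multiples of [x]. *)
Lemma normalize_relation x (q : {poly algC}) n : (forall i, A q`_i) ->
    (size q <= n.+1)%N -> pi * q.[x] = 1 ->
  exists q' : {poly algC}, [/\ forall i, A q'`_i, (size q' <= n)%N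
    & pi * (x * q'.[x]) = 1].
Proof.
move=> hq sq qx; pose u := 1 - pi * q`_0.
have Au : A u^-1 by exact: one_sub_unit.
have u0 : u != 0.
  apply: contra_notN ApV => /eqP /subr0_eq h.
  by rewrite -[pi^-1]mulr1 h mulKf.
pose r := \poly_(i < n) q`_i.+1.
have qE : q.[x] = q`_0 + x * r.[x].
  rewrite (@horner_coef_wide _ n.+1) // big_ord_recl expr0 mulr1; congr (_ + _).
  rewrite horner_poly mulr_sumr; apply: eq_bigr => i _.
  by rewrite exprS mulrCA.
exists (u^-1 *: r); split=> [i||].
- by rewrite coefZ coef_poly; apply: AM => //; case: ifP.
- by rewrite (leq_trans (size_scale_leq _ _)) ?size_poly.
- have ur : u = pi * (x * r.[x]) by rewrite /u -[X in X - _]qx qE; ring.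
  by rewrite hornerZ [x * _]mulrCA [pi * _]mulrCA -ur mulVf.
Qed.

(** The descent of Chevalley's extension theorem: the shorter relation, multiplied by a power of
    [x], rewrites the top power in the longer one as [pi] times lower powers, and so shortens it. *)
Lemma relations_absurd N x (q r : {poly algC}) : x != 0 ->
    (size q + size r <= N)%N -> (forall i, A q`_i) -> (forall i, A r`_i) ->
  pi * (x * q.[x]) = 1 -> pi * (x^-1 * r.[x^-1]) = 1 -> False.
Proof.
elim: N x q r => [|N IH] x q r x0.
  rewrite leqn0 addn_eq0 size_poly_eq0 => /andP[/eqP -> _] _ _ /eqP.
  by rewrite horner0 !mulr0 eq_sym oner_eq0.
wlog rq : x q r x0 / (size r <= size q)%N.
  move=> W; case/orP: (leq_total (size r) (size q)) => le; first exact: W.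
  by rewrite addnC => ? ? ? ? ?; apply: (W x^-1 r q); rewrite ?invr_eq0 ?invrK.
move=> sN hq hr qx rx.
case: (posnP (size q)) => [/eqP|].
  rewrite size_poly_eq0 => /eqP q0; move: qx => /eqP.
  by rewrite q0 horner0 !mulr0 eq_sym oner_eq0.
case sq : (size q) => [//|n] _.
(* [t] is [x * q] without its top term, and [s] is [r] with its coefficients reversed. *)
pose t := \poly_(i < n.+1) (if i is j.+1 then q`_j else 0).
pose s := \poly_(i < n.+1) r`_(n - i).
have xn : x ^+ n.+1 = pi * s.[x].
  rewrite -[LHS]mulr1 -rx mulrCA; congr (_ * _).
  rewrite exprSr mulrA mulfK // (@horner_coef_wide _ n.+1) -?sq // sq.
  rewrite horner_poly mulr_sumr [RHS](reindex_inj rev_ord_inj) /=.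
  apply: eq_bigr => i _; have le : (i <= n)%N by rewrite -ltnS.
  rewrite subSS subKn // mulrCA; congr (_ * _).
  by rewrite exprVn -expfB_cond // (negbTE x0).
have tq : x * q.[x] = t.[x] + q`_n * x ^+ n.+1.
  rewrite (@horner_coef_wide _ n.+1) ?sq // big_ord_recr mulrDr /=.
  congr (_ + _); last by rewrite mulrCA exprS.
  rewrite horner_poly big_ord_recl mul0r add0r mulr_sumr.
  by apply: eq_bigr => i _; rewrite exprS mulrCA.
pose T := t + (pi * q`_n) *: s.
have hT i : A T`_i.
  rewrite coefD coefZ !coef_poly; apply: AD; first by case: ifP => //; case: i.
  by apply: AM; [apply: AM => //; exact: An|case: ifP].
have Tx : pi * T.[x] = 1.
  by rewrite -qx tq xn /T hornerD hornerZ; ring.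
have sT : (size T <= n.+1)%N.
  rewrite (leq_trans (size_polyD _ _)) // geq_max size_poly.
  by rewrite (leq_trans (size_scale_leq _ _)) // size_poly.
have [q' [hq' sq' qx']] := normalize_relation hT sT Tx.
apply: (IH x q' r) => //; rewrite -ltnS (leq_trans _ sN) //.
by rewrite sq addSn ltnS leq_add2r.
Qed.

Lemma noninverting_valuation x : x != 0 -> ~ A x -> A x^-1.
Proof.
move=> x0 /overring_inverts[q [hq qx]]; apply: contrapT => /overring_inverts[r [hr rx]].
have [q' [hq' _ qx']] := normalize_relation hq (leqnSn _) qx.
have [r' [hr' _ rx']] := normalize_relation hr (leqnSn _) rx.
exact: (relations_absurd x0 (leqnn _) hq' hr' qx' rx').
Qed.

(** By Bezout a multiple of [m] has the form [1 - pi * s], a unit of [A]. *)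
Lemma noninverting_coprime m : coprime p m -> A (m%:R)^-1.
Proof.
move=> pm; have /coprimezP[[s t] /= st] : coprimez p m by rewrite coprimezE.
have h : t%:~R * m%:R = 1 - pi * s%:~R :> algC.
  have : (s * p + t * m)%:~R = 1 :> algC by rewrite st.
  rewrite rmorphD !rmorphM /= => E; apply: (addrI (pi * s%:~R)).
  by rewrite subrKC -[RHS]E mulrC.
have m0 : m%:R != 0 :> algC.
  rewrite pnatr_eq0; apply: contraTneq pm => ->.
  by rewrite /coprime gcdn0 gtn_eqF // prime_gt1.
have u0 : t%:~R != 0 :> algC.
  apply: contra_notN ApV => /eqP t0; move: h; rewrite t0 mul0r => /esym/subr0_eq h.
  by rewrite -[pi^-1]mulr1 h mulKf.
have -> : m%:R^-1 = t%:~R * (1 - pi * s%:~R)^-1 :> algC.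
  by rewrite -h invfM mulVKf.
by apply: AM => //; apply: one_sub_unit.
Qed.

Lemma noninverting_pow (n : int) : A (pi ^ n) -> 0 <= n.
Proof.
case: n => // n; rewrite NegzE -exprnN => h; exfalso; apply: ApV.
have -> : pi^-1 = pi ^+ n * pi ^- n.+1.
  by rewrite exprSr invfM mulrA mulfV ?mul1r // expf_neq0.
by apply: AM => //; apply: AX; exact: An.
Qed.

(** Algebraicity makes the valuation real-valued here. If [z] is not in [A], then [z^-1] is;
    dividing an integer equation of degree [n] and leading coefficient [c] by [z ^+ n.-1] writes
    [c * z] as a polynomial in [z^-1]. Only the [p]-part of [c] is needed, the rest being invertible
    in [A]. *)
Lemma noninverting_scale z : exists k, A (z * pi ^+ k).
Proof.
have [Az'|nAz] := pselect (A z); first by exists 0%N; rewrite expr0 mulr1.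
have z0 : z != 0 by apply: contra_not_neq nAz => ->.
have Ay := noninverting_valuation z0 nAz.
have [f [fE fm] fP] := minCpolyP z.
have [g [a a0 gE]] := rat_poly_scale f.
have g0 : g != 0.
  apply: contraTneq fm => g0; rewrite gE g0 rmorph0 scaler0.
  by rewrite monicE lead_coef0 eq_sym oner_eq0.
have gz : (map_poly intr g : {poly algC}).[z] = 0.
  have : root (map_poly ratr f) z by rewrite fP.
  rewrite gE map_polyZ rootZ; last by rewrite fmorph_eq0 invr_eq0 intr_eq0.
  rewrite -map_poly_comp => /eqP <-; congr (_.[_]).
  by apply: eq_map_poly => c /=; rewrite ratr_int.
pose c := lead_coef g; pose n := (size g).-1.
have cz : A (c%:~R * z).
  have sg : size g = n.+1 by rewrite prednK // lt0n size_poly_eq0.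
  have : (map_poly intr g : {poly algC}).[z] * z^-1 ^+ n * z = 0.
    by rewrite gz !mul0r.
  rewrite (@horner_coef_wide _ n.+1); last first.
    by rewrite size_map_inj_poly ?sg //; exact: intr_inj.
  rewrite big_ord_recr /= coef_map /= -[g`_n]/c.
  rewrite mulrDl -mulrA exprVn mulfV ?mulr1 ?expf_neq0 // mulrDl addrC.
  move=> /eqP; rewrite addr_eq0 => /eqP ->; apply: AN.
  rewrite !mulr_suml; apply: Asum => i _; rewrite coef_map /= -!mulrA.
  apply: AM => //.
  set d := z ^+ (n - i.+1).
  have e : z ^+ n = z ^+ i * d * z.
    by rewrite -exprD -exprSr -addnS -subSn // subSS subnKC // ltnW.
  have zi0 : z ^+ i != 0 by rewrite expf_neq0.
  have d0 : d != 0 by rewrite expf_neq0.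
  have -> : z ^+ i * (z ^- n * z) = d^-1 by rewrite e; field; rewrite z0 zi0 d0.
  by rewrite -exprVn; exact: AX.
have c0 : (0 < `|c|)%N by rewrite absz_gt0 lead_coef_eq0.
have [m pm cE] := pfactor_coprime pp c0.
exists (logn p `|c|).
have m0 : m%:R != 0 :> algC.
  by rewrite pnatr_eq0; apply: contraTneq c0 => m0; rewrite cE m0 mul0n.
have absA (d : int) : A (d%:~R * z) -> A (`|d|%N%:R * z).
  by case: d => d //; rewrite NegzE rmorphN mulNr => /AN; rewrite opprK.
have -> : z * pi ^+ logn p `|c| = m%:R^-1 * (`|c|%N%:R * z).
  by rewrite {2}cE natrM natrX -mulrA mulKf // mulrC.
apply: AM; first exact: noninverting_coprime.
exact: absA.
Qed.

(** The rationals not exceeding the valuation of [z], normalised to 1 at [p]: [a / b.+1] is one when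
    [z ^+ b.+1] divided by [pi ^ a] lies in [A]. Their supremum gives the real valuation without
    building the value group. *)
Definition padic_slopes (z : algC) : set R :=
  [set s | exists (a : int) (b : nat),
     A (z ^+ b.+1 * pi ^ (- a)) /\ s = a%:~R / b.+1%:R].

Definition padic_val z := sup (padic_slopes z).

Lemma padic_slopesD y z s t : padic_slopes y s -> padic_slopes z t ->
  padic_slopes (y * z) (s + t).
Proof.
move=> [a [b [hy ->]]] [a' [b' [hz ->]]].
exists (a * b'.+1%:Z + a' * b.+1%:Z), (b.+1 * b'.+1).-1.
rewrite prednK ?muln_gt0 //; split; last first.
  rewrite natrM rmorphD !rmorphM /= -!pmulrn.
  have b0 : b.+1%:R != 0 :> R by rewrite pnatr_eq0.
  have b'0 : b'.+1%:R != 0 :> R by rewrite pnatr_eq0.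
  by move: (b.+1%:R) (b'.+1%:R) b0 b'0 => B B' B0 B'0; field; rewrite B0 B'0.
have -> : (y * z) ^+ (b.+1 * b'.+1) * pi ^ (- (a * b'.+1%:Z + a' * b.+1%:Z)) =
    (y ^+ b.+1 * pi ^ (- a)) ^+ b'.+1 * (z ^+ b'.+1 * pi ^ (- a')) ^+ b.+1.
  have Ez (c : int) n : pi ^ (- (c * n%:Z)) = (pi ^ (- c)) ^+ n.
    by rewrite -mulNr -exprz_exp.
  by rewrite opprD expfzDr // !Ez !exprMn -!exprM [(b'.+1 * b.+1)%N]mulnC mulrACA.
by apply: AM; exact: AX.
Qed.

Lemma padic_slopes1 s : padic_slopes 1 s -> s <= 0.
Proof.
move=> [a [b [h ->]]]; move: h; rewrite expr1n mul1r => /noninverting_pow.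
by rewrite oppr_ge0 => a0; rewrite pmulr_lle0 ?invr_gt0 ?ltr0n // lerz0.
Qed.

Lemma padic_slopes_nonempty z : padic_slopes z !=set0.
Proof.
have [k hk] := noninverting_scale z.
exists (- k%:R); exists (- k%:Z), 0%N; rewrite expr1 opprK; split=> //.
by rewrite divr1 rmorphN.
Qed.

(** A slope of [z] and one of [z^-1] add up to a slope of 1, which is at most 0. *)
Lemma padic_slopes_bounded z : z != 0 -> has_ubound (padic_slopes z).
Proof.
move=> z0; have [t ht] := padic_slopes_nonempty z^-1.
exists (- t) => s hs; rewrite -subr_le0 opprK; apply: padic_slopes1.
by rewrite -(mulfV z0); exact: padic_slopesD.
Qed.

Lemma padic_val_ge z s : z != 0 -> padic_slopes z s -> s <= padic_val z.
Proof. by move=> z0 hs; apply: ub_le_sup => //; exact: padic_slopes_bounded. Qed.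

Lemma padic_val_superadd y z : y != 0 -> z != 0 ->
  padic_val y + padic_val z <= padic_val (y * z).
Proof.
move=> y0 z0; rewrite -lerBrDr; apply: ge_sup (padic_slopes_nonempty y) _ => s hs.
rewrite lerBrDr addrC -lerBrDr; apply: ge_sup (padic_slopes_nonempty z) _ => t ht.
rewrite lerBrDr addrC; apply: padic_val_ge; first by rewrite mulf_neq0.
exact: padic_slopesD.
Qed.

(** The valuation ring property enters here: if a rational is not a slope of [z], its opposite is a
    slope of [z^-1]. *)
Lemma padic_valV_ge z : z != 0 -> - padic_val z <= padic_val z^-1.
Proof.
move=> z0; rewrite lerNl leNgt; apply/negP => lt.
have [q] := rat_in_itvoo lt; rewrite in_itv /= => /andP[lq ltq].
have [b bE] : exists b, denq q = b.+1%:Z.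
  by case: (denq q) (denq_gt0 q) => [[|b]|//] // _; exists b.
have qE : ratr q = (numq q)%:~R / b.+1%:R :> R by rewrite /ratr bE.
have nA : ~ A (z ^+ b.+1 * pi ^ (- numq q)).
  move=> h; move: lq; rewrite ltNge => /negP; apply.
  by apply: padic_val_ge => //; exists (numq q), b.
have := noninverting_valuation (mulf_neq0 (expf_neq0 _ z0) (expfz_neq0 _ pi0)) nA.
rewrite invfM -exprVn invr_expz opprK => h.
have : - ratr q <= padic_val z^-1.
  apply: padic_val_ge; first by rewrite invr_eq0.
  by exists (- numq q), b; rewrite opprK; split=> //; rewrite qE rmorphN mulNr.
by rewrite lerNl leNgt ltq.
Qed.

Lemma padic_valM y z : y != 0 -> z != 0 ->
  padic_val (y * z) = padic_val y + padic_val z.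
Proof.
move=> y0 z0; apply/eqP; rewrite eq_le padic_val_superadd // andbT.
have yz0 := mulf_neq0 y0 z0.
have zV0 : z^-1 != 0 by rewrite invr_eq0.
have := padic_val_superadd yz0 zV0; rewrite mulfK //.
by have := padic_valV_ge z0; lra.
Qed.

Lemma padic_val_integral z : z != 0 -> A z -> 0 <= padic_val z.
Proof.
move=> z0 Az'; apply: padic_val_ge => //; exists 0, 0%N.
by rewrite mul0r oppr0 expr0z mulr1 expr1.
Qed.

Lemma padic_val1 : padic_val 1 = 0.
Proof.
have := padic_valM (oner_neq0 _) (oner_neq0 _); rewrite mulr1; lra.
Qed.

Lemma padic_valV z : z != 0 -> padic_val z^-1 = - padic_val z.
Proof.
move=> z0; have zV0 : z^-1 != 0 by rewrite invr_eq0.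
by have := padic_valM z0 zV0; rewrite mulfV // padic_val1; lra.
Qed.

Lemma padic_val_p : padic_val pi = 1.
Proof.
have piV0 : pi^-1 != 0 by rewrite invr_eq0.
have h1 : 1 <= padic_val pi.
  apply: padic_val_ge => //; exists 1, 0%N.
  by rewrite expr1 exprN1 mulfV // divr1.
have : - 1 <= padic_val pi^-1.
  apply: padic_val_ge => //; exists (- 1), 0%N.
  by rewrite expr1 opprK expr1z mulVf // divr1 rmorphN.
by rewrite padic_valV //; lra.
Qed.

Lemma padic_val_coprime m : coprime p m -> padic_val m%:R = 0.
Proof.
move=> pm; have m0 : m%:R != 0 :> algC.
  rewrite pnatr_eq0; apply: contraTneq pm => ->.
  by rewrite /coprime gcdn0 gtn_eqF // prime_gt1.
have mV0 : m%:R^-1 != 0 :> algC by rewrite invr_eq0.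
have := padic_val_integral m0 (An m).
by have := padic_val_integral mV0 (noninverting_coprime pm); rewrite padic_valV //; lra.
Qed.

Lemma padic_valX z n : z != 0 -> padic_val (z ^+ n) = n%:R * padic_val z.
Proof.
move=> z0; elim: n => [|n IH]; first by rewrite expr0 mul0r padic_val1.
by rewrite exprS padic_valM ?expf_neq0 // IH -natr1; ring.
Qed.

Lemma padic_val_nat n : (0 < n)%N -> padic_val n%:R = (logn p n)%:R.
Proof.
move=> n0; have [m pm nE] := pfactor_coprime pp n0.
have m0 : m%:R != 0 :> algC.
  by rewrite pnatr_eq0; apply: contraTneq n0 => m0; rewrite nE m0 mul0n.
rewrite {1}nE natrM natrX padic_valM ?expf_neq0 // padic_valX // padic_val_p.
by rewrite padic_val_coprime // add0r mulr1.
Qed.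

Lemma padic_val_int (n : int) : n != 0 -> padic_val n%:~R = (logn p `|n|)%:R.
Proof.
move=> n0; have nn : (0 < `|n|)%N by rewrite absz_gt0.
have N1 : padic_val (-1) = 0.
  have n10 : -1 != 0 :> algC by rewrite oppr_eq0 oner_eq0.
  by have := padic_valM n10 n10; rewrite mulrNN mulr1 padic_val1; lra.
case: n n0 nn => n n0 nn; first by rewrite padic_val_nat.
rewrite NegzE rmorphN /= -mulN1r padic_valM ?oppr_eq0 ?oner_eq0 ?pnatr_eq0 //.
by rewrite N1 add0r padic_val_nat.
Qed.

Definition padic_ext_fun (z : algC) : R :=
  if z == 0 then 0 else p%:R `^ (- padic_val z).

Let pR0 : 0 < p%:R :> R. Proof. by rewrite ltr0n prime_gt0. Qed.

Lemma padic_ext_le y z : y != 0 -> z != 0 -> A (y / z) ->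
  padic_ext_fun y <= padic_ext_fun z.
Proof.
move=> y0 z0 h; rewrite /padic_ext_fun (negbTE y0) (negbTE z0) ler_powR //.
  by rewrite ler1n prime_gt0.
rewrite lerN2 -[y](divfK z0) padic_valM ?mulf_neq0 ?invr_eq0 // lerDr.
by apply: padic_val_integral => //; rewrite mulf_neq0 ?invr_eq0.
Qed.

Lemma padic_ext_ge0 z : 0 <= padic_ext_fun z.
Proof. by rewrite /padic_ext_fun; case: ifP => // _; exact: powR_ge0. Qed.

Lemma padic_ext_eq0 z : padic_ext_fun z = 0 -> z = 0.
Proof.
rewrite /padic_ext_fun; case: eqP => // _ /eqP.
by rewrite gt_eqF // powR_gt0.
Qed.

Lemma padic_ext0 : padic_ext_fun 0 = 0.
Proof. by rewrite /padic_ext_fun eqxx. Qed.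

Lemma padic_extM y z : padic_ext_fun (y * z) = padic_ext_fun y * padic_ext_fun z.
Proof.
have [->|y0] := eqVneq y 0; first by rewrite mul0r padic_ext0 mul0r.
have [->|z0] := eqVneq z 0; first by rewrite mulr0 padic_ext0 mulr0.
rewrite /padic_ext_fun mulf_eq0 (negbTE y0) (negbTE z0) /= padic_valM // opprD powRD //.
by apply/implyP => _; rewrite gt_eqF.
Qed.

(** One of [y / z] and [z / y] lies in the valuation ring, and so does that quotient plus 1. *)
Lemma padic_ext_ultra y z :
  padic_ext_fun (y + z) <= Num.max (padic_ext_fun y) (padic_ext_fun z).
Proof.
have [->|y0] := eqVneq y 0; first by rewrite add0r le_max lexx orbT.
have [->|z0] := eqVneq z 0; first by rewrite addr0 le_max lexx.
have [yz0|yz0] := eqVneq (y + z) 0.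
  by rewrite yz0 padic_ext0 le_max padic_ext_ge0.
rewrite le_max; apply/orP; have [h|h] := pselect (A (y / z)).
  right; apply: padic_ext_le => //; rewrite mulrDl mulfV //.
  exact: AD.
left; apply: padic_ext_le => //; rewrite mulrDl mulfV //; apply: AD => //.
rewrite -[z / y]invrK invfM invrK mulrC; apply: noninverting_valuation => //.
by rewrite mulf_neq0 ?invr_eq0.
Qed.

Lemma padic_extD y z : padic_ext_fun (y + z) <= padic_ext_fun y + padic_ext_fun z.
Proof.
rewrite (le_trans (padic_ext_ultra y z)) // ge_max.
by rewrite lerDl lerDr !padic_ext_ge0.
Qed.

Lemma padic_ext_rat q : padic_ext_fun (ratr q) = padic_abs R p q.
Proof.
rewrite /padic_ext_fun /padic_abs fmorph_eq0; case: eqVneq => // q0.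
have n0 : numq q != 0 by rewrite numq_eq0.
have d0 : denq q != 0 by exact: denq_neq0.
rewrite /ratr padic_valM ?invr_eq0 ?intr_eq0 // padic_valV ?intr_eq0 //.
rewrite !padic_val_int // -powR_intmul ?ltW //; congr (_ `^ _).
by rewrite rmorphB /= -!pmulrn; ring.
Qed.

End PadicExtension.

Lemma exists_padic_absval (R : realType) (p : nat) : prime p ->
  exists w : absval R algC, (forall q : rat, w (ratr q) = padic_abs R p q) /\
    (forall y z, w (y + z) <= Num.max (w y) (w z)).
Proof.
move=> pp; have [A [gA maxA]] := maximal_noninverting pp.
unshelve eexists.
  apply: (@AbsVal R algC (@padic_ext_fun R p A)).
  - exact: padic_ext_ge0.
  - exact: padic_ext_eq0.
  - exact: padic_ext0.
  - exact: padic_extM.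
  - exact: padic_extD.
split=> [q|y z]; first exact: padic_ext_rat.
exact: padic_ext_ultra.
Qed.

(** * Conjugates and local Mahler measures *)

Definition conjugates (x : algC) : seq algC :=
  sval (closed_field_poly_normal (minCpoly x)).

Lemma minCpoly_conjugates x : minCpoly x = \prod_(y <- conjugates x) ('X - y%:P).
Proof.
rewrite /conjugates; case: closed_field_poly_normal => r /= {1}->.
by rewrite (monicP (minCpoly_monic x)) scale1r.
Qed.

Lemma mem_conjugates x y : (y \in conjugates x) = root (minCpoly x) y.
Proof. by rewrite minCpoly_conjugates root_prod_XsubC. Qed.

Lemma conjugates_id x : x \in conjugates x.
Proof. by rewrite mem_conjugates root_minCpoly. Qed.

Lemma size_conjugates x : (size (conjugates x)).+1 = size (minCpoly x).
Proof. by rewrite minCpoly_conjugates size_prod_XsubC. Qed.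

Lemma deriv_neq0 (p : {poly rat}) : p \is monic -> (1 < size p)%N -> p^`() != 0.
Proof.
move=> pm sp; apply/eqP => /(congr1 (coefp (size p).-2)) /eqP.
rewrite /= coef_deriv coef0 prednK ?ltn_predRL // -[p`__]/(lead_coef p).
by rewrite (monicP pm) pnatr_eq0; case: (size p) sp => [|[]].
Qed.

Lemma uniq_conjugates x : uniq (conjugates x).
Proof.
rewrite -separable_prod_XsubC -minCpoly_conjugates.
have sx := size_minCpoly x; have [f [fE fm] fP] := minCpolyP x.
rewrite fE separable_map; move: sx; rewrite fE size_map_poly => sf.
have f0 := monic_neq0 fm; have f'0 := deriv_neq0 fm sf.
set g := gcdp f f^`(); have g0 : g != 0 by rewrite gcdp_eq0 negb_and f0.
have /dvdpP[c cE] := dvdp_gcdl f f^`().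
have : root (map_poly ratr (c * g)) x by rewrite -cE fP.
rewrite rmorphM rootM => /orP[]; rewrite fP => h.
  have c0 : c != 0 by apply: contraNneq f0 => c0; rewrite cE c0 mul0r.
  have := dvdp_leq c0 h; rewrite {1}cE size_mul // -subn1 leq_subLR addnC leq_add2r.
  by move=> sg; rewrite unlock /coprimep eqn_leq sg size_poly_gt0.
have := dvdp_leq f'0 (dvdp_trans h (dvdp_gcdr _ _)).
by rewrite leqNgt lt_size_deriv.
Qed.

Definition local_mahler (R : realType) (w : absval R algC) (x : algC) : R :=
  \prod_(y <- conjugates x) Num.max 1 (w y).

Lemma local_mahler_ge1 (R : realType) (w : absval R algC) x : 1 <= local_mahler w x.
Proof.
rewrite /local_mahler; elim/big_ind: _ => // [y z y1 z1|y _].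
  by rewrite -[1]mulr1 ler_pM.
by rewrite le_max lexx.
Qed.

(* Index [0] is the archimedean place, a prime [p] is the [p]-adic one; other
   indices are unused. *)
Definition rat_abs (R : realType) (i : nat) : absval R algC :=
  if @idP (prime i) is ReflectT h then sval (cid (exists_padic_absval R h))
  else complex_abs R.

Definition rat_index (i : nat) := (i == 0%N) || prime i.

Section RatAbs.

Variable R : realType.

Lemma rat_abs_prime p : prime p ->
  (forall q : rat, rat_abs R p (ratr q) = padic_abs R p q) /\
  (forall y z, rat_abs R p (y + z) <= Num.max (rat_abs R p y) (rat_abs R p z)).
Proof.
move=> pp; rewrite /rat_abs; case: {-}_ / idP => [h|//].
by case: (cid _).
Qed.

Lemma rat_abs0 : rat_abs R 0 = complex_abs R.
Proof. by rewrite /rat_abs; case: {-}_ / idP. Qed.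

Lemma rat_abs0_rat (q : rat) : rat_abs R 0 (ratr q) = `|ratr q|.
Proof. by rewrite rat_abs0; exact: complex_abs_rat. Qed.

Lemma rat_index_over i : rat_index i ->
  (forall q : rat, rat_abs R i (ratr q) = `|ratr q|) \/
  (exists2 p, prime p & forall q : rat, rat_abs R i (ratr q) = padic_abs R p q).
Proof.
case/orP => [/eqP ->|ip]; first by left=> q; rewrite rat_abs0_rat.
by right; exists i => // q; rewrite (rat_abs_prime ip).1.
Qed.

Lemma padic_abs_nat p n : (0 < n)%N -> padic_abs R p n%:R = p%:R ^- logn p n.
Proof.
move=> n0; rewrite /padic_abs pnatr_eq0 eqn0Ngt n0 /=.
rewrite -[n%:R]/((Posz n)%:~R) numq_int denq_int /= logn1 sub0r.
by rewrite exprnN.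
Qed.

Lemma rat_abs_gt1 p : prime p -> rat_abs R 0 p%:R > 1.
Proof.
move=> pp; rewrite -(ratr_nat algC) rat_abs0_rat ratr_nat ger0_norm //.
by rewrite ltr1n prime_gt1.
Qed.

Lemma rat_abs_lt1 p : prime p -> rat_abs R p p%:R < 1.
Proof.
move=> pp; rewrite -(ratr_nat algC) (rat_abs_prime pp).1 padic_abs_nat ?prime_gt0 //.
by rewrite logn_prime // eqxx expr1 invf_lt1 ?ltr0n ?prime_gt0 // ltr1n prime_gt1.
Qed.

Lemma rat_abs_coprime p n : prime p -> (0 < n)%N -> ~~ (p %| n)%N ->
  rat_abs R p n%:R = 1.
Proof.
move=> pp n0 pn; rewrite -(ratr_nat algC) (rat_abs_prime pp).1 padic_abs_nat //.
have -> : logn p n = 0%N; last by rewrite expr0 invr1.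
by apply/eqP; rewrite -leqn0 leqNgt logn_gt0 mem_primes pp n0.
Qed.

(** The value at a prime [p] separates the places: it is below 1 at [p], equal to 1 at other primes,
    above 1 at the archimedean place. *)
Lemma rat_index_inj i j : rat_index i -> rat_index j ->
  (forall q : rat, rat_abs R i (ratr q) = rat_abs R j (ratr q)) -> i = j.
Proof.
have aux p k : prime p -> rat_index k -> (forall q : rat,
    rat_abs R p (ratr q) = rat_abs R k (ratr q)) -> p = k.
  move=> pp /orP[/eqP ->|kp] e; have := e p%:R; rewrite ratr_nat.
    by move=> h; have := rat_abs_lt1 pp; rewrite h ltNge ltW // rat_abs_gt1.
  move=> h; apply/eqP; apply: contraT => pk.
  have := rat_abs_lt1 pp; rewrite h rat_abs_coprime ?ltxx ?prime_gt0 //.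
  by rewrite dvdn_prime2 // eq_sym.
case/orP => [/eqP ->|ip] jr e; last exact: aux.
case/orP: (jr) => [/eqP -> //|jp]; apply/esym/aux => // q.
Qed.

End RatAbs.

Section Ultrametric.

Variables (R : realType) (w : absval R algC).
Hypothesis ultra : forall y z, w (y + z) <= Num.max (w y) (w z).

Lemma ultra_sum_le I (r : seq I) (P : pred I) (f : I -> algC) (B : R) : 0 <= B ->
  (forall i, P i -> w (f i) <= B) -> w (\sum_(i <- r | P i) f i) <= B.
Proof.
move=> B0 h; elim/big_ind: _ => [|y z yB zB|//]; first by rewrite absval0.
by rewrite (le_trans (ultra _ _)) // ge_max yB zB.
Qed.

Lemma ultra_root_le1 (f : {poly algC}) y : f \is monic ->
  (forall i, w f`_i <= 1) -> root f y -> w y <= 1.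
Proof.
move=> fm fi /eqP; rewrite leNgt => fy; apply/negP => y1.
have wy0 : 0 < w y by apply: lt_trans y1.
have sf : size f = (size f).-1.+1.
  by rewrite prednK // size_poly_gt0 monic_neq0.
case sE : (size f).-1 sf => [|n] sf.
  move: fy; rewrite horner_coef sf big_ord1 expr0 mulr1 => /eqP.
  have := monicP fm; rewrite /lead_coef sf /= => ->.
  by rewrite oner_eq0.
have ynE : y ^+ n.+1 = - \sum_(i < n.+1) f`_i * y ^+ i.
  have fn : f`_n.+1 = 1 by have := monicP fm; rewrite /lead_coef sf.
  have := fy; rewrite horner_coef sf big_ord_recr /= fn mul1r addrC => /eqP.
  by rewrite addr_eq0 => /eqP.
have : w y ^+ n.+1 <= w y ^+ n.
  rewrite -absvalX ynE absvalN; apply: ultra_sum_le => [|i _].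
    by rewrite exprn_ge0 ?absval_ge0.
  rewrite absvalM absvalX -[leRHS]mul1r ler_pM ?absval_ge0 ?exprn_ge0 ?absval_ge0 //.
  by rewrite ler_weXn2l ?ltW // -ltnS.
by rewrite exprSr ger_pMr ?exprn_gt0 // leNgt y1.
Qed.

End Ultrametric.

Lemma local_mahler_prime_eq1 (R : realType) (x : algC) :
  exists N0, forall p, prime p -> (N0 <= p)%N ->
    forall y, y \in conjugates x -> rat_abs R p y <= 1.
Proof.
have [f [fE fm] _] := minCpolyP x; have [g [a a0 gE]] := rat_poly_scale f.
(* [a] is a common denominator of the minimal polynomial; a prime above its absolute value does not
   divide it, so all coefficients are [p]-integral. *)
exists (`|a|%N).+1 => p pp ap y; rewrite mem_conjugates.
have [hq ultra] := rat_abs_prime R pp.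
apply: ultra_root_le1 => //; first exact: minCpoly_monic.
have wnat m : rat_abs R p m%:R <= 1.
  elim: m => [|m IH]; first by rewrite absval0.
  by rewrite -natr1 (le_trans (ultra _ _)) // ge_max IH absval1 lexx.
have wint (m : int) : rat_abs R p m%:~R <= 1.
  case: m => m; first exact: wnat.
  by rewrite NegzE rmorphN absvalN; exact: wnat.
move=> i; rewrite fE gE coef_map coefZ coef_map /= rmorphM fmorphV /= !ratr_int.
rewrite absvalM absvalV.
have -> : rat_abs R p a%:~R = 1; last by rewrite invr1 mul1r.
have an : (0 < `|a|)%N by rewrite absz_gt0.
have -> : rat_abs R p a%:~R = rat_abs R p `|a|%N%:R.
  by case: (a) => m //; rewrite NegzE rmorphN absvalN.
rewrite rat_abs_coprime //; apply/negP => /dvdn_leq; rewrite an => /(_ isT).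
by rewrite leqNgt ap.
Qed.

(** Raising the height to the global degree, as [mahler] does, leaves the local degree as an
    integral exponent, ready to be read as a number of conjugates. *)
Lemma max1_powR (R : realType) (y : R) d n : 0 <= y -> (0 < n)%N ->
  Num.max 1 (y `^ (d%:R / n%:R)) ^+ n = Num.max 1 y ^+ d.
Proof.
move=> y0 n0; have yn : (y `^ (d%:R / n%:R)) ^+ n = y ^+ d.
  rewrite -powR_mulrn ?powR_ge0 // -powRrM divfK ?pnatr_eq0 -?lt0n //.
  by rewrite powR_mulrn.
have [y1|y1] := leP y 1.
  rewrite expr1n (_ : Num.max _ _ = 1) ?expr1n //.
  apply/max_idPl; rewrite -(@ler_pXn2r _ n) ?nnegrE ?powR_ge0 // yn expr1n.
  by rewrite exprn_ile1.
rewrite (_ : Num.max _ _ = y `^ (d%:R / n%:R)) ?yn //.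
apply/max_idPr; rewrite -(@ler_pXn2r _ n) ?nnegrE ?powR_ge0 // yn expr1n.
by rewrite exprn_ege1 // ltW.
Qed.

(** * The Mahler measure as a product of local measures *)

Section MahlerFormula.

Variables (R : realType) (x : algC).

Local Notation K := (adjoin_field x).
Local Notation g := (adjoin_gen x).
Local Notation w := (rat_abs R).
Local Notation s := (conjugates x).

Lemma adjoin_horner (q : {poly rat}) :
  adjoin_emb x (map_poly (in_alg K) q).[g] = (map_poly ratr q).[x].
Proof.
rewrite -horner_map adjoin_genP -map_poly_comp; congr (_.[_]).
by apply: eq_map_poly => c /=; rewrite rmorphZ_num rmorph1 mulr1.
Qed.

Lemma adjoin_minpoly : exists f : {poly rat},
  (forall q : {poly rat}, (f %| q) = ((map_poly (in_alg K) q).[g] == 0)) /\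
  map_poly ratr f = \prod_(y <- s) ('X - y%:P) :> {poly algC}.
Proof.
have [f [fE _] fP] := minCpolyP x; exists f; split; last first.
  by rewrite -fE minCpoly_conjugates.
by move=> q; rewrite -fP rootE -adjoin_horner fmorph_eq0.
Qed.

Local Notation ind i := (induces g (w i)).

Lemma induces_cst i (v : K -> R) y (q : rat) : ind i v y -> v q%:A = w i (ratr q).
Proof. by move=> /(_ q%:P); rewrite !map_polyC !hornerC. Qed.

Lemma induces_gen i (v : K -> R) y : ind i v y -> v g = w i y.
Proof. by move=> /(_ 'X); rewrite !map_polyX !hornerX. Qed.

Lemma exists_place i y : rat_index i -> y \in s ->
  exists v : place R K, ind i v y.
Proof.
move=> hi ys; have [f [fx fs]] := adjoin_minpoly.
exact: (place_of_root (adjoin_gen_full x) fx fs ys (rat_index_over R hi)).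
Qed.

Lemma place_index (v : place R K) : exists2 i, rat_index i &
  forall q : rat, v q%:A = w i (ratr q).
Proof.
case: (place_over v) => [hv|[p pp hv]].
  by exists 0%N => // q; rewrite hv rat_abs0_rat.
exists p; first by rewrite /rat_index pp orbT.
by move=> q; rewrite hv (rat_abs_prime R pp).1.
Qed.

Lemma local_degree_count (v : place R K) i :
    (forall q : rat, v q%:A = w i (ratr q)) ->
  local_degree v = count (fun y => `[< ind i v y >]) s /\ (0 < local_degree v)%N.
Proof.
have [f [fx fs]] := adjoin_minpoly.
exact: (induces_count (adjoin_gen_full x) fx fs (uniq_conjugates x)).
Qed.

(** The pairs of an index and a conjugate are grouped by the place they induce; a group has as many
    elements as the local degree. All large [N] are allowed so that two numbers can be compared over
    a common range. *)
Lemma mahler_local_product : exists N0, forall N, (N0 <= N)%N ->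
  mahler R x = \prod_(i <- iota 0 N | rat_index i) local_mahler (w i) x.
Proof.
have [N0 hN0] := local_mahler_prime_eq1 R x.
exists N0.+1 => N NN.
(* [v0] is the default value of [pl] on irrelevant pairs. *)
have [v0 _] := exists_place (isT : rat_index 0) (conjugates_id x).
have exv (iy : nat * algC) : exists v : place R K,
    rat_index iy.1 -> iy.2 \in s -> ind iy.1 v iy.2.
  case: iy => i y; have [hi|ni] := boolP (rat_index i); last by exists v0.
  have [ys|ys] := boolP (y \in s); last by exists v0.
  by have [v hv] := exists_place hi ys; exists v.
have [pl hpl] := choice exv.
pose I := [seq i <- iota 0 N | rat_index i].
have Irat i : i \in I -> rat_index i by rewrite mem_filter => /andP[].
pose L := [seq (i, y) | i <- I, y <- s].
pose r := undup [seq pl iy | iy <- L].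
pose G (iy : nat * algC) := Num.max 1 (w iy.1 iy.2).
pose F (v : place R K) := Num.max 1 (normalized_abs v g).
have surj (v : place R K) : exists i y, [/\ rat_index i, y \in s & v = pl (i, y)].
  have [i hi vi] := place_index v; have [dE] := local_degree_count vi.
  rewrite dE -has_count => /hasP[y ys /asboolP hy].
  exists i, y; split=> //; apply: (induces_eq (adjoin_gen_full x) hy).
  exact: (hpl (i, y)).
have plE (v : place R K) i y : rat_index i -> y \in s ->
    (pl (i, y) == v) = `[< ind i v y >].
  move=> hi ys; apply/eqP/asboolP => [<-|hv]; first exact: (hpl (i, y)).
  by apply: (induces_eq (adjoin_gen_full x) _ hv); exact: (hpl (i, y)).
have hE : field_height R g = \prod_(v <- r) F v.
  rewrite /field_height (fsbigE r) //=; first by apply: eq_bigl => v; rewrite in_setT.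
    exact: undup_uniq.
  (* A place missing from [r] lies over a prime beyond the bound, where its factor is 1. *)
  move=> v _ vr; have [i [y [hi ys vE]]] := surj v.
  have vgy : v g = w i y by rewrite vE; exact: (induces_gen (hpl (i, y) hi ys)).
  have iN : (N <= i)%N.
    rewrite leqNgt; apply: contra vr => iN; rewrite mem_undup vE map_f //.
    by apply/allpairsPdep; exists i, y; rewrite mem_filter hi mem_iota.
  have ip : prime i by case/orP: hi => // /eqP i0; move: (leq_trans NN iN); rewrite i0.
  apply/max_idPl; rewrite /normalized_abs vgy.
  have y1 : w i y <= 1 by apply: hN0 => //; rewrite ltnW // (leq_trans NN).
  set e := (_ / _); have e1 : 1 `^ e = 1 :> R by rewrite powR1.
  rewrite -[leRHS]e1.
  by apply: ge0_ler_powR; rewrite ?nnegrE ?absval_ge0 ?divr_ge0.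
rewrite /mahler /weil_height hE -prodrXl.
have FE v : v \in r -> F v ^+ \dim {:K} = \prod_(iy <- L | pl iy == v) G iy.
  rewrite mem_undup => /mapP[iy /allpairsPdep[i [y [iI ys ->]]] vE].
  have hi := Irat _ iI.
  have vi (q : rat) : v q%:A = w i (ratr q).
    by rewrite vE; exact: (induces_cst _ (hpl (i, y) hi ys)).
  rewrite /F /normalized_abs max1_powR ?absval_ge0 ?adim_gt0 //.
  rewrite (local_degree_count vi).1.
  rewrite big_mkcond big_allpairs_dep /=.
  rewrite (bigD1_seq i) ?filter_uniq ?iota_uniq //= [X in _ * X]big1_seq ?mulr1.
    rewrite -big_mkcond /= -iter_mulr_1 -big_const_seq big_seq_cond [RHS]big_seq_cond.
    apply: eq_big => [y'|y' /andP[ys' /asboolP hy']].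
      by case: (boolP (y' \in s)) => //= ys'; rewrite plE.
    by rewrite /G /= (induces_gen hy').
  (* Other indices contribute nothing, as [v] restricts to a single absolute value of [rat]. *)
  move=> j /andP[ji jI]; rewrite big1_seq // => y' /andP[_ ys'].
  case: eqP => // vE'; case/negP: ji; apply/eqP.
  apply: (@rat_index_inj R) => // [|q]; first exact: Irat.
  rewrite -vi -vE'; apply/esym.
  exact: (induces_cst _ (hpl (j, y') (Irat _ jI) ys')).
rewrite (eq_big_seq _ FE) (exchange_big_dep xpredT) //=.
rewrite -[RHS]big_filter -/I.
transitivity (\prod_(iy <- L) G iy); last by rewrite big_allpairs_dep.
apply: eq_big_seq => iy iyL.
rewrite -big_filter (_ : [seq v <- r | pl iy == v] = [:: pl iy]) ?big_seq1 //.
have plr : pl iy \in r by rewrite mem_undup map_f.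
rewrite (@eq_filter _ _ (pred1 (pl iy))); last by move=> v /=; rewrite eq_sym.
by rewrite filter_pred1_uniq ?undup_uniq.
Qed.

End MahlerFormula.

(** * Comparison and finiteness of Mahler measures *)

Lemma prod_ge1 (R : realType) I (r : seq I) (P : pred I) (f : I -> R) :
  (forall i, P i -> 1 <= f i) -> 1 <= \prod_(i <- r | P i) f i.
Proof.
move=> h; elim/big_ind: _ => // y z y1 z1.
by rewrite -[1]mulr1 ler_pM.
Qed.

Lemma mahler_ge1 (R : realType) x : 1 <= mahler R x.
Proof.
have [N0 /(_ _ (leqnn _)) ->] := mahler_local_product R x.
by apply: prod_ge1 => i _; exact: local_mahler_ge1.
Qed.

Lemma mahler_le (R : realType) x y :
    (forall w : absval R algC, local_mahler w x <= local_mahler w y) ->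
  mahler R x <= mahler R y.
Proof.
move=> h; have [N1 h1] := mahler_local_product R x.
have [N2 h2] := mahler_local_product R y.
rewrite (h1 (maxn N1 N2)) ?leq_maxl // (h2 (maxn N1 N2)) ?leq_maxr //.
apply: ler_prod => i _; rewrite h andbT.
exact: le_trans ler01 (local_mahler_ge1 _ _).
Qed.

Lemma mahler_minCpoly (R : realType) x y :
  minCpoly x = minCpoly y -> mahler R x = mahler R y.
Proof.
move=> e; apply/eqP; rewrite eq_le !mahler_le // => w;
  by rewrite /local_mahler /conjugates e.
Qed.

Lemma conjugate_root x y (q : {poly rat}) : y \in conjugates x ->
  root (map_poly ratr q) x -> root (map_poly ratr q) y.
Proof.
rewrite mem_conjugates; have [f [-> _] fP] := minCpolyP x => fy.
by rewrite fP => /dvdpP[c ->]; rewrite rmorphM rootM fy orbT.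
Qed.

Lemma conjugateX x y d : y \in conjugates x -> y ^+ d \in conjugates (x ^+ d).
Proof.
move=> yx; rewrite mem_conjugates; have [f [fE _] _] := minCpolyP (x ^+ d).
have h z : root (map_poly ratr (f \Po 'X^d)) z = root (minCpoly (x ^+ d)) (z ^+ d).
  by rewrite fE map_comp_poly map_polyXn !rootE horner_comp hornerXn.
by rewrite -h; apply: conjugate_root yx _; rewrite h root_minCpoly.
Qed.

(* The conjugates [y] of [x] with a given [y ^+ d = z] all have the same absolute
   value, and there are at most [d] of them. *)
Lemma local_mahler_root (R : realType) (w : absval R algC) x d : (0 < d)%N ->
  local_mahler w x <= local_mahler w (x ^+ d).
Proof.
move=> d0; rewrite /local_mahler.
have -> : \prod_(y <- conjugates x) Num.max 1 (w y) =
    \prod_(z <- conjugates (x ^+ d)) \prod_(y <- conjugates x | y ^+ d == z)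
      Num.max 1 (w y).
  rewrite (exchange_big_dep xpredT) //=; apply: eq_big_seq => y yx.
  rewrite -big_filter (_ : [seq _ <- _ | _] = [:: y ^+ d]) ?big_seq1 //.
  rewrite (@eq_filter _ _ (pred1 (y ^+ d))); last by move=> v /=; rewrite eq_sym.
  by rewrite filter_pred1_uniq ?uniq_conjugates // conjugateX.
apply: ler_prod => z _; apply/andP; split.
  by apply: (le_trans ler01); apply: prod_ge1 => y _; rewrite le_max lexx.
rewrite -big_filter; set T := [seq y <- conjugates x | y ^+ d == z].
have [T0|T0] := eqVneq T [::]; first by rewrite T0 big_nil le_max lexx.
have [y0 y0T] : exists y, y \in T by case: T T0 => // y t _; exists y; rewrite mem_head.
have Tz y : y \in T -> y ^+ d = z by rewrite mem_filter => /andP[/eqP].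
have wT y : y \in T -> w y = w y0.
  move=> yT; apply/eqP; rewrite -(@eqrXn2 _ d) ?absval_ge0 // -!absvalX.
  by rewrite !Tz.
have -> : Num.max 1 (w z) = Num.max 1 (w y0) ^+ d.
  rewrite -(Tz _ y0T) absvalX; case: (leP (w y0) 1) => h.
    by rewrite expr1n; apply/max_idPl; rewrite exprn_ile1 ?absval_ge0.
  by apply/max_idPr; rewrite exprn_ege1 // ltW.
have -> : \prod_(y <- T) Num.max 1 (w y) = Num.max 1 (w y0) ^+ size T.
  transitivity (\prod_(y <- T) Num.max 1 (w y0)).
    by apply: eq_big_seq => y yT; rewrite wT.
  by rewrite big_const_seq count_predT iter_mulr_1.
rewrite ler_weXn2l ?le_max ?lexx //.
have uT : uniq T by rewrite filter_uniq ?uniq_conjugates.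
rewrite -ltnS -(size_XnsubC z d0); apply: max_poly_roots => //.
  by rewrite -size_poly_eq0 size_XnsubC.
by apply/allP => y yT; rewrite rootE !hornerE Tz // subrr.
Qed.

Lemma mahler_root (R : realType) x d : (0 < d)%N -> mahler R x <= mahler R (x ^+ d).
Proof. by move=> d0; apply: mahler_le => w; exact: local_mahler_root. Qed.

Lemma mahler1 (R : realType) : mahler R 1 = 1.
Proof.
have [N0 /(_ _ (leqnn _)) ->] := mahler_local_product R 1.
apply: big1 => i _; apply: big1_seq => y /andP[_ yc].
have E : map_poly ratr ('X - 1) = 'X - 1%:P :> {poly algC}.
  by rewrite rmorphB rmorph1 /= map_polyX.
have : root (map_poly ratr ('X - 1)) y.
  by apply: conjugate_root yc _; rewrite E root_XsubC.
rewrite E root_XsubC => /eqP ->.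
by rewrite absval1; apply/max_idPl.
Qed.

Lemma mahler_unity_root (R : realType) z n : (0 < n)%N -> z ^+ n = 1 ->
  mahler R z = 1.
Proof.
move=> n0 zn; apply/eqP; rewrite eq_le mahler_ge1 andbT.
by rewrite -(mahler1 R) -zn mahler_root.
Qed.

(** The constant [c] serves both kinds of places: 2 at the archimedean one, 1 at the ultrametric
    ones. *)
Lemma coef_prod_XsubC_le (R : realType) (w : absval R algC) (c : R) (s : seq algC) i :
    1 <= c -> (forall y z, w (y + z) <= c * Num.max (w y) (w z)) ->
  w (\prod_(y <- s) ('X - y%:P))`_i <= c ^+ size s * \prod_(y <- s) Num.max 1 (w y).
Proof.
move=> c1 hc; elim: s i => [|y s IH] i.
  rewrite !big_nil expr0 mulr1 coefC; case: ifP => _; first by rewrite absval1.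
  by rewrite absval0.
rewrite !big_cons /=; set q := \prod_(y <- s) _ in IH *.
set M := _ * _ in IH; set m := Num.max 1 (w y).
have m1 : 1 <= m by rewrite le_max lexx.
have M0 : 0 <= M by exact: le_trans (absval_ge0 _ _) (IH 0%N).
have -> : c ^+ (size s).+1 * (m * \prod_(y <- s) Num.max 1 (w y)) = c * (m * M).
  by rewrite exprS /M; ring.
rewrite mulrBl coefB coefCM coefXM (le_trans (hc _ _)) //.
rewrite ler_pM2l ?(lt_le_trans ltr01) // ge_max absvalN absvalM; apply/andP; split.
  apply: (@le_trans _ _ M); last by rewrite ler_peMl.
  by case: ifP => _; rewrite ?absval0.
by rewrite ler_pM ?absval_ge0 // le_max lexx orbT.
Qed.

(** Primitivity is put prime by prime because the bound below needs, at each [p], a coefficient of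
    absolute value 1. *)
Lemma exists_primitive_minpoly x : exists2 G : {poly int},
  (forall p, prime p -> exists i, ~~ (p %| `|(G`_i)%R|)%N) &
  G != 0 /\ map_poly intr G = (lead_coef G)%:~R *: minCpoly x :> {poly algC}.
Proof.
have [f [fE fm] _] := minCpolyP x; have [g [a a0 gE]] := rat_poly_scale f.
have g0 : g != 0.
  apply: contraTneq fm => g0; rewrite gE g0 rmorph0 scaler0.
  by rewrite monicE lead_coef0 eq_sym oner_eq0.
pose G := zprimitive g.
have G0 : G != 0 by rewrite zprimitive_eq0.
exists G => [p pp|].
  apply: contrapT => /forallNP h.
  have : (p%:Z %| zcontents G)%Z.
    rewrite dvdz_contents; apply/polyOverP => i; rewrite /= dvdzE.
    by apply: contrapT => /negP /h.
  rewrite zcontents_primitive g0 dvdzE /= dvdn1 => /eqP p1.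
  by move: pp; rewrite p1.
split=> //.
have e : map_poly intr g = (zcontents g)%:~R *: map_poly intr G :> {poly algC}.
  by rewrite {1}[g]zpolyEprim map_polyZ.
have fE' : minCpoly x = (a%:~R^-1 * (zcontents g)%:~R) *: map_poly intr G.
  rewrite fE gE map_polyZ -map_poly_comp fmorphV /= ratr_int -scalerA -e; congr (_ *: _).
  by apply: eq_map_poly => c /=; rewrite ratr_int.
have := monicP (minCpoly_monic x); rewrite {1}fE' lead_coefZ.
rewrite lead_coef_map_inj ?rmorph0 //; last exact: intr_inj.
by move=> kl; rewrite fE' scalerA mulrC kl scale1r.
Qed.

(** The archimedean factor bounds the coefficients of [G] up to the leading coefficient [a], and the
    primes bound [a]: a coefficient of [G] prime to [p] is [a] times a coefficient of the minimal
    polynomial, so the latter has as absolute value the [p]-part of [a], and the local measure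
    dominates it. *)
Lemma mahler_coef_bound (R : realType) x (G : {poly int}) i :
    (forall p, prime p -> exists i, ~~ (p %| `|(G`_i)%R|)%N) -> G != 0 ->
    map_poly intr G = (lead_coef G)%:~R *: minCpoly x :> {poly algC} ->
  `|(G`_i)%R|%N%:R <= 2 ^+ size (conjugates x) * mahler R x.
Proof.
move=> prim G0 GE; set a := lead_coef G.
have an : (0 < `|a|)%N by rewrite absz_gt0 lead_coef_eq0.
have [N0 hN] := mahler_local_product R x.
(* [N] exceeds the absolute value of [a], so the product reaches every prime divisor of [a]. *)
rewrite (hN (maxn N0 `|a|.+1).+1); last by rewrite leqW // leq_maxl.
set N := (maxn _ _).+1.
have GiE j : (G`_j)%:~R = a%:~R * (\prod_(y <- conjugates x) ('X - y%:P))`_j :> algC.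
  have := congr1 (coefp j) GE; rewrite /= coef_map coefZ /= => ->.
  by rewrite minCpoly_conjugates.
have wabs (w : absval R algC) (m : int) : w m%:~R = w `|m|%N%:R.
  by case: m => m //; rewrite NegzE rmorphN absvalN.
have w0 (m : int) : rat_abs R 0 m%:~R = `|m|%N%:R.
  by rewrite wabs -(ratr_nat algC) rat_abs0_rat ratr_nat ger0_norm.
have h0 : `|(G`_i)%R|%N%:R <= `|a|%N%:R *
    (2 ^+ size (conjugates x) * local_mahler (rat_abs R 0) x).
  rewrite -!w0 GiE absvalM ler_wpM2l ?absval_ge0 //.
  apply: coef_prod_XsubC_le; first by rewrite ler1n.
  move=> y z; rewrite (le_trans (absvalD _ _ _)) // mulr_natl mulr2n.
  by rewrite lerD // le_max lexx ?orbT.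
have hp p : prime p -> p%:R ^+ logn p `|a| <= local_mahler (rat_abs R p) x.
  move=> pp; have [j pj] := prim p pp; have [_ ultra] := rat_abs_prime R pp.
  have Gj : (0 < `|(G`_j)%R|)%N.
    by rewrite lt0n; apply: contraNneq pj => ->; rewrite dvdn0.
  have := rat_abs_coprime R pp Gj pj; rewrite -wabs GiE absvalM wabs.
  rewrite -(ratr_nat algC) (rat_abs_prime R pp).1 padic_abs_nat // => /eqP.
  have pn0 : 0 < p%:R ^+ logn p `|a| :> R by rewrite exprn_gt0 ?ltr0n ?prime_gt0.
  rewrite mulrC -[_ == 1]/(_ / _ == 1) eq_sym.
  rewrite -(can2_eq (mulfK _) (divfK _)) ?lt0r_neq0 //.
  rewrite mul1r => /eqP ->.
  have := @coef_prod_XsubC_le R (rat_abs R p) 1 (conjugates x) j (lexx _).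
  by rewrite expr1n mul1r; apply=> y z; rewrite mul1r; exact: ultra.
have ha : `|a|%N%:R <= \prod_(i <- iota 0 N | prime i) local_mahler (rat_abs R i) x.
  have e : `|a|%N = (\prod_(0 <= p < N | prime p) p ^ logn p `|a|)%N.
    rewrite -{1}(partnT an) (@widen_partn N.-1); last by rewrite /N /= ltnW // leq_maxr.
    rewrite [LHS](bigID prime) /= [X in (_ * X)%N]big1 ?muln1 // => p np.
    by rewrite lognE (negbTE np).
  rewrite [X in X%:R]e natr_prod /index_iota subn0.
  apply: ler_prod => p pp; rewrite natrX hp // andbT exprn_ge0 //.
rewrite (le_trans h0) // [X in _ <= _ * X](bigID (pred1 0%N)) /=.
have -> : \prod_(j <- iota 0 N | rat_index j && (j == 0%N)) local_mahler (rat_abs R j) x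
    = local_mahler (rat_abs R 0) x.
  rewrite -big_filter (_ : [seq _ <- _ | _] = [:: 0%N]) ?big_seq1 //.
  rewrite (@eq_filter _ _ (pred1 0%N)); last first.
    by move=> j /=; rewrite /rat_index; case: (j == 0%N); rewrite ?andbF.
  by rewrite filter_pred1_uniq ?iota_uniq // mem_iota.
have -> : \prod_(j <- iota 0 N | rat_index j && (j != 0%N)) local_mahler (rat_abs R j) x
    = \prod_(j <- iota 0 N | prime j) local_mahler (rat_abs R j) x.
  by apply: eq_bigl => j; rewrite /rat_index; case: eqP => [->|_]; rewrite ?andbT.
have m0 := le_trans ler01 (local_mahler_ge1 (rat_abs R 0) x).
rewrite mulrC -!mulrA ler_wpM2l ?exprn_ge0 // ler_wpM2l //.
Qed.

(** The measure depends only on the minimal polynomial, hence on a primitive integer multiple of it;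
    bounded degree and coefficients leave finitely many, coded in [T] by absolute values and
    signs. *)
Lemma northcott_mahler (R : realType) (D : nat) (B : R) :
  finite_set [set m : R | exists x,
    [/\ m = mahler R x, (size (conjugates x) <= D)%N & m <= B]].
Proof.
pose C := (Num.truncn (2 ^+ D * Num.max 0 B)).+1.
pose T := {ffun 'I_D.+1 -> 'I_C * bool}.
pose G (t : T) : {poly int} :=
  \poly_(i < D.+1) (if insub i is Some j then
    (-1) ^+ (t j).2 * (nat_of_ord (t j).1)%:Z else 0).
pose good (t : T) x :=
  map_poly intr (G t) = (lead_coef (G t))%:~R *: minCpoly x :> {poly algC} /\ G t != 0.
(* Any number whose minimal polynomial is coded by [t] will do, since all of them have the same
   measure. *)
pose F (t : T) : R := mahler R (xget 0 [set x | good t x]).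
apply: (@sub_finite_set _ _ (F @` [set: T])); last exact/finite_image/finite_finset.
move=> m [x [-> sx mB]].
have [H prim [H0 HE]] := exists_primitive_minpoly x.
have hb i : (`|(H`_i)%R|%N < C)%N.
  rewrite -(ltr_nat R) (le_lt_trans (mahler_coef_bound R i prim H0 HE)) //.
  apply: le_lt_trans (truncnS_gt _); apply: ler_pM.
  - by rewrite exprn_ge0.
  - exact: le_trans ler01 (mahler_ge1 R x).
  - by rewrite ler_weXn2l // ler1n.
  - by rewrite le_max mB orbT.
pose t : T := [ffun j : 'I_D.+1 => (Ordinal (hb j), (H`_j < 0))].
have sH : (size H <= D.+1)%N.
  have := congr1 (fun p : {poly algC} => size p) HE.
  rewrite size_map_inj_poly ?rmorph0 //; last exact: intr_inj.
  by rewrite size_scale ?intr_eq0 ?lead_coef_eq0 // -size_conjugates => ->.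
have GH : G t = H.
  apply/polyP => i; rewrite coef_poly; case: ltnP => [iD|Di]; last first.
    by rewrite nth_default // (leq_trans sH).
  by rewrite insubT ffunE /= -intEsign.
exists t => //; apply: mahler_minCpoly.
have gx : good t x by split; rewrite GH.
have := xgetPex 0 (ex_intro _ x gx : exists y, [set x | good t x] y).
set y := xget _ _ => -[yE _]; have [xE Gt0] := gx.
have l0 : (lead_coef (G t))%:~R != 0 :> algC by rewrite intr_eq0 lead_coef_eq0.
by apply: (scalerI l0); rewrite -yE -xE.
Qed.

(** * Norms to a Galois subfield *)

Section GaloisNumberField.

Variables (L : splittingFieldType rat) (io : {rmorphism L -> algC}).
Hypothesis galL : galois 1 {:L}.

Local Notation G := 'Gal({:L} / 1)%g.

Lemma map_poly_in_alg (L' : fieldExtType rat) (io' : {rmorphism L' -> algC})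
    (q : {poly rat}) : map_poly io' (map_poly (in_alg L') q) = map_poly ratr q.
Proof.
rewrite -map_poly_comp; apply: eq_map_poly => c /=.
by rewrite rmorphZ_num rmorph1 mulr1.
Qed.

Lemma conjugates_galP b y :
  y \in conjugates (io b) <-> exists2 s : gal_of {:L}, s \in G & y = io (s b).
Proof.
have /polyOver1P[f fE] := minPolyOver 1%AS b.
have fb : root (map_poly ratr f) (io b).
  by rewrite -(map_poly_in_alg io) -fE fmorph_root root_minPoly.
split=> [yb|[s sG ->]].
  have := conjugate_root yb fb; rewrite -(map_poly_in_alg io) -fE.
  have /normalFieldP/(_ b (memvf b))[r _ rE] := normalFieldf (L := L) 1%AS.
  rewrite rE map_prod_XsubC root_prod_XsubC => /mapP[c cr ->].
  have cb : root (minPoly 1 b) c by rewrite rE root_prod_XsubC.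
  have [s sG <-] :=
    normalField_root_minPoly (sub1v _) (normalFieldf 1%AS) (memvf b) cb.
  by exists s.
rewrite mem_conjugates; have [q [qE _] _] := minCpolyP (io b).
have := root_minCpoly (io b); rewrite qE -(map_poly_in_alg io) !fmorph_root => qb.
have sq : map_poly s (map_poly (in_alg L) q) = map_poly (in_alg L) q.
  by apply: (fixedPoly_gal (sub1v _) sG); apply/polyOver1P; exists q.
by rewrite -sq fmorph_root.
Qed.

Variable K : {subfield L}.
Hypothesis nK : normalField 1 K.

Local Notation H := 'Gal({:L} / K)%g.

(** Repetitions are removed: with the multiplicities of [galNorm] an element of [K] would be
    replaced by a power of itself, and its measure could grow. *)
Definition orbit_seq (b : L) : seq L := undup [seq (h : gal_of _) b | h <- enum H].
Definition orbit_norm (b : L) : L := \prod_(c <- orbit_seq b) c.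

Lemma mem_orbit_seqP b c :
  reflect (exists2 h : gal_of {:L}, h \in H & c = h b) (c \in orbit_seq b).
Proof.
rewrite mem_undup; apply: (iffP mapP) => -[h].
  by rewrite mem_enum; exists h.
by exists h; rewrite ?mem_enum.
Qed.

Lemma orbit_seq_id b : b \in orbit_seq b.
Proof. by apply/mem_orbit_seqP; exists 1%g; rewrite ?group1 ?gal_id. Qed.

Lemma orbit_seq_same b c : c \in orbit_seq b -> perm_eq (orbit_seq c) (orbit_seq b).
Proof.
case/mem_orbit_seqP => h hH ->; apply: uniq_perm; rewrite ?undup_uniq // => z.
apply/mem_orbit_seqP/mem_orbit_seqP => -[k kH ->].
  by exists (h * k)%g; [exact: groupM|rewrite galM ?memvf].
exists (h^-1 * k)%g; first by rewrite groupM ?groupV.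
by rewrite -[RHS]galM ?memvf // mulgA mulgV mul1g.
Qed.

(** [K] is normal, so conjugation by [s] permutes [H] and [s] carries [H]-orbits to [H]-orbits. *)
Lemma orbit_seq_gal (s : gal_of {:L}) b : s \in G ->
  perm_eq (orbit_seq (s b)) [seq s c | c <- orbit_seq b].
Proof.
move=> sG; have HG : (H <| G)%g.
  by apply: normalField_normal; rewrite ?sub1v ?subvf.
have nsH : (s \in 'N(H))%g by exact: (fintype.subsetP (normal_norm HG)) sG.
apply: uniq_perm; rewrite ?undup_uniq //.
  by rewrite map_inj_uniq ?undup_uniq //; exact: fmorph_inj.
move=> z; apply/mem_orbit_seqP/mapP => [[h hH ->]|[c /mem_orbit_seqP[h hH ->] ->]].
  exists ((h ^ s^-1)%g b); last first.
    by rewrite -!galM ?memvf // conjgE invgK -!mulgA mulVg mulg1.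
  by apply/mem_orbit_seqP; exists (h ^ s^-1)%g; rewrite // memJ_norm ?groupV.
exists (h ^ s)%g; first by rewrite memJ_norm.
by rewrite -!galM ?memvf // conjgE mulKVg.
Qed.

Lemma orbit_norm_gal (s : gal_of {:L}) b : s \in G ->
  orbit_norm (s b) = s (orbit_norm b).
Proof.
move=> sG; rewrite /orbit_norm (perm_big _ (orbit_seq_gal b sG)) big_map.
by rewrite rmorph_prod.
Qed.

Lemma orbit_norm_same b c : c \in orbit_seq b -> orbit_norm c = orbit_norm b.
Proof. by move=> /orbit_seq_same h; rewrite /orbit_norm (perm_big _ h). Qed.

Lemma sub_galG : H \subset G. Proof. by rewrite galS ?sub1v. Qed.

Lemma galK : galois K {:L}.
Proof. by apply: galoisS galL; rewrite sub1v subvf. Qed.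

Lemma orbit_norm_mem b : orbit_norm b \in K.
Proof.
have /galois_fixedField <- := galK.
apply/fixedFieldP => [|h hH]; first exact: memvf.
rewrite -orbit_norm_gal ?(fintype.subsetP sub_galG) //; apply: orbit_norm_same.
by apply/mem_orbit_seqP; exists h.
Qed.

Lemma orbit_norm_neq0 b : b != 0 -> orbit_norm b != 0.
Proof.
move=> b0; rewrite prodf_seq_neq0; apply/allP => c /mem_orbit_seqP[h _ ->].
by rewrite fmorph_eq0.
Qed.

(** Orbit-stabiliser: each conjugate is reached by a coset of the stabiliser, hence by the same
    number [k] of automorphisms. *)
Lemma galNorm_orbit_norm b : exists2 k, galNorm K {:L} b = orbit_norm b ^+ k &
  (k * size (orbit_seq b))%N = #|H|.
Proof.
pose k := #|[set h in H | (h : gal_of {:L}) b == b]|.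
have fib c : c \in orbit_seq b -> #|[set h in H | (h : gal_of {:L}) b == c]| = k.
  case/mem_orbit_seqP => g gH ->; rewrite /k -[RHS](card_rcoset _ g).
  apply: eq_card => h.
  rewrite mem_rcoset !inE groupMr ?groupV //.
  case: (boolP (h \in H)) => //= hH; rewrite galM ?memvf //.
  apply/eqP/eqP => [->|e]; first by rewrite -galM ?memvf // mulgV gal_id.
  by rewrite -[in RHS]e -[RHS]galM ?memvf // mulVg gal_id.
exists k.
  rewrite /galNorm /orbit_norm -prodrXl.
  transitivity (\prod_(c <- orbit_seq b) \prod_(h in H | (h : gal_of {:L}) b == c) h b).
    rewrite (exchange_big_dep (mem H)) /=; last by move=> c h _ /andP[].
    apply: eq_bigr => h hH; rewrite -big_filter.
    rewrite (@eq_filter _ _ (pred1 (h b))); last by move=> v /=; rewrite hH eq_sym.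
    rewrite filter_pred1_uniq ?undup_uniq ?big_seq1 //.
    by apply/mem_orbit_seqP; exists h.
  apply: eq_big_seq => c cb; rewrite -(fib c cb) -prodr_const.
  by apply: eq_big => [h|h /andP[_ /eqP]]; rewrite ?inE.
rewrite -sum1_card.
transitivity (\sum_(c <- orbit_seq b) \sum_(h in H | (h : gal_of {:L}) b == c) 1)%N.
  have -> : (k * size (orbit_seq b) = \sum_(c <- orbit_seq b) k)%N.
    by rewrite big_const_seq count_predT iter_addn_0.
  apply: eq_big_seq => c cb.
  by rewrite -(fib c cb) -sum1_card; apply: eq_bigl => h; rewrite inE.
rewrite (exchange_big_dep (mem H)) /=; last by move=> c h _ /andP[].
apply: eq_bigr => h hH; rewrite -big_filter.
rewrite (@eq_filter _ _ (pred1 (h b))); last by move=> v /=; rewrite hH eq_sym.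
rewrite filter_pred1_uniq ?undup_uniq ?big_seq1 //.
by apply/mem_orbit_seqP; exists h.
Qed.

(* Distinct conjugates of [orbit_norm a] are norms of disjoint blocks of conjugates
   of [a]. *)
Lemma local_mahler_orbit_norm (R : realType) (w : absval R algC) a :
  local_mahler w (io (orbit_norm a)) <= local_mahler w (io a).
Proof.
pose B := undup [seq (s : gal_of {:L}) a | s <- enum G].
have BP b : reflect (exists2 s : gal_of {:L}, s \in G & b = s a) (b \in B).
  rewrite mem_undup; apply: (iffP mapP) => -[s].
    by rewrite mem_enum; exists s.
  by exists s; rewrite ?mem_enum.
have cB : perm_eq (conjugates (io a)) (map io B).
  apply: uniq_perm; rewrite ?uniq_conjugates ?(map_inj_uniq (fmorph_inj io)) //.
    exact: undup_uniq.
  move=> y; apply/idP/mapP => [/conjugates_galP[s sG ->]|[b /BP[s sG ->] ->]].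
    by exists (s a) => //; apply/BP; exists s.
  by apply/conjugates_galP; exists s.
rewrite /local_mahler (perm_big _ cB) big_map.
have -> : \prod_(b <- B) Num.max 1 (w (io b)) =
    \prod_(z <- conjugates (io (orbit_norm a)))
      \prod_(b <- B | io (orbit_norm b) == z) Num.max 1 (w (io b)).
  rewrite (exchange_big_dep xpredT) //=; apply: eq_big_seq => b /BP[s sG bE].
  rewrite -big_filter.
  rewrite (@eq_filter _ _ (pred1 (io (orbit_norm b)))); last first.
    by move=> v /=; rewrite eq_sym.
  rewrite filter_pred1_uniq ?uniq_conjugates ?big_seq1 //.
  by apply/conjugates_galP; exists s; rewrite // bE orbit_norm_gal.
rewrite big_seq_cond [leRHS]big_seq_cond; apply: ler_prod => z.
rewrite andbT => /conjugates_galP[s sG ->]; rewrite le_max ler01 /=.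
rewrite -orbit_norm_gal //; set b0 := s a.
rewrite -big_filter; set T := [seq b <- B | _].
(* Different orbits may have the same norm, so [T] can be larger than the orbit of [b0]; the extra
   factors are at least 1. *)
have sub : {subset orbit_seq b0 <= T}.
  move=> c cb; rewrite mem_filter (orbit_norm_same cb) eqxx /=.
  case/mem_orbit_seqP: cb => h hH ->; apply/BP; exists (s * h)%g.
    by rewrite groupM // (fintype.subsetP sub_galG).
  by rewrite galM ?memvf.
have sz c : 1 <= Num.max 1 (w (io c)) by rewrite le_max lexx.
apply: (@le_trans _ _ (\prod_(c <- orbit_seq b0) Num.max 1 (w (io c)))).
  rewrite ge_max prod_ge1 //= /orbit_norm rmorph_prod absval_prod.
  by apply: ler_prod => c _; rewrite absval_ge0 le_max lexx orbT.
have pe : perm_eq (orbit_seq b0) [seq b <- T | b \in orbit_seq b0].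
  apply: uniq_perm; rewrite ?filter_uniq ?undup_uniq // => c.
  rewrite [RHS]mem_filter andbC; case: (boolP (c \in orbit_seq b0)) => [/sub ->|] //.
  by rewrite andbF.
rewrite (perm_big _ pe) big_filter [leRHS](bigID (mem (orbit_seq b0))) /=.
rewrite ler_peMr ?prod_ge1 //.
by apply: (le_trans ler01); apply: prod_ge1.
Qed.

End GaloisNumberField.

(** Adjoining all conjugates yields the splitting field of a rational polynomial, which is separable
    in characteristic 0. *)
Lemma exists_galois_number_field (s : seq algC) :
  exists (L : splittingFieldType rat) (io : {rmorphism L -> algC}),
    galois 1 {:L} /\ forall x y, x \in s -> y \in conjugates x -> exists b, y = io b.
Proof.
pose t := flatten [seq conjugates x | x <- s].
have [Q [QC [s1 s1t gen]]] := num_field_exists t.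
have [q qE] : exists q : {poly rat},
    map_poly ratr q = \prod_(y <- t) ('X - y%:P) :> {poly algC}.
  rewrite /t; elim: (s) => [|x s' [q' q'E]] /=.
    by exists 1; rewrite rmorph1 big_nil.
  have [f [fE _] _] := minCpolyP x; exists (f * q').
  by rewrite rmorphM /= q'E -fE minCpoly_conjugates big_cat.
have pE : \prod_(c <- s1) ('X - c%:P) = map_poly (in_alg Q) q.
  apply: (map_inj_poly (fmorph_inj QC) (rmorph0 QC)).
  by rewrite map_poly_in_alg qE -s1t map_prod_XsubC.
have split : splitting_field_axiom Q.
  exists (\prod_(c <- s1) ('X - c%:P)); first by rewrite pE; apply/polyOver1P; exists q.
  by exists s1; rewrite ?eqpxx.
pose mx := FieldExt_isSplittingField.Build rat Q split.
pose L : splittingFieldType rat := HB.pack (FieldExt.sort Q) mx.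
exists L, QC; split.
  rewrite /galois sub1v normalFieldf andbT; apply/separableP => c _ /=.
  by apply: pcharf0_separable => p; rewrite pchar_lalg pchar_num.
move=> x y xs yx.
have : y \in map QC s1 by rewrite s1t; apply/flatten_mapP; exists x.
by case/mapP => b _ ->; exists b.
Qed.

(** * Reduction to radicals *)

Lemma range_adjoin (L L' : fieldExtType rat) (io : {rmorphism L -> algC})
    (j : {rmorphism L' -> algC}) (rs : seq L) :
    (forall c, c \in rs -> range j (io c)) ->
  forall z, z \in <<1 & rs>>%VS -> range j (io z).
Proof.
elim/last_ind: rs => [|rs c IH] hrs z.
  rewrite adjoin_nil (subfield_closed 1%AS) => /vlineP[q ->].
  by exists q%:A => //; rewrite !rmorphZ_num !rmorph1.
rewrite adjoin_rcons => /Fadjoin_polyP[p /polyOverP hp ->].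
have hc : range j (io c) by apply: hrs; rewrite mem_rcons mem_head.
have {}IH y : y \in <<1 & rs>>%VS -> range j (io y).
  by apply: IH => b br; apply: hrs; rewrite mem_rcons in_cons br orbT.
rewrite horner_coef rmorph_sum; elim/big_ind: _ => [|_ _ [y _ <-] [y' _ <-]|i _].
- by exists 0 => //; rewrite rmorph0.
- by exists (y + y') => //; rewrite rmorphD.
- have [y _ yE] := IH _ (hp i); have [y' _ yE'] := hc.
  by exists (y * y' ^+ i) => //; rewrite !rmorphM !rmorphXn /= yE yE'.
Qed.

Lemma dim_adjoin_seq_le (L : fieldExtType rat) (n : nat) (rs : seq L) :
    (forall c, c \in rs -> (adjoin_degree 1%AS c <= n)%N) ->
  (\dim <<1 & rs>>%VS <= n ^ size rs)%N.
Proof.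
elim/last_ind: rs => [|rs c IH] hrs.
  by rewrite adjoin_nil (subfield_closed 1%AS) dimv1.
rewrite adjoin_rcons (dim_Fadjoin <<1 & rs>>%AS) size_rcons expnS leq_mul //.
  have hc : (adjoin_degree 1%AS c <= n)%N by apply: hrs; rewrite mem_rcons mem_head.
  apply: leq_trans hc; rewrite -ltnS -!size_minPoly dvdp_leq //.
    by rewrite monic_neq0 ?monic_minPoly.
  by rewrite minPolyS ?sub1v.
by apply: IH => b br; apply: hrs; rewrite mem_rcons in_cons br orbT.
Qed.

Lemma size_conjugates_le (L : fieldExtType rat) (io : {rmorphism L -> algC}) b :
  (size (conjugates (io b)) <= adjoin_degree 1%AS b)%N.
Proof.
have /polyOver1P[f fE] := minPolyOver 1%AS b.
have [q [qE _] qP] := minCpolyP (io b).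
rewrite -ltnS size_conjugates qE size_map_poly -size_minPoly fE size_map_poly.
apply: dvdp_leq.
  by rewrite -(map_poly_eq0 (in_alg L)) -fE monic_neq0 ?monic_minPoly.
by rewrite -qP -(map_poly_in_alg io) -fE fmorph_root root_minPoly.
Qed.

Lemma adjoin_degree_le (L : fieldExtType rat) (io : {rmorphism L -> algC}) x b :
  io b \in conjugates x -> (adjoin_degree 1%AS b <= size (conjugates x))%N.
Proof.
move=> bx; have [q [qE qm] _] := minCpolyP x.
rewrite -ltnS -size_minPoly size_conjugates qE size_map_poly.
rewrite -(size_map_poly (in_alg L)) dvdp_leq ?map_poly_eq0 ?monic_neq0 //.
apply: minPoly_dvdp; first by apply/polyOver1P; exists q.
by rewrite -(fmorph_root io) map_poly_in_alg -qE -mem_conjugates.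
Qed.

(** Any Galois field that contains [alpha] contains its conjugates, hence the field they
    generate. *)
Lemma galois_closure_adjoin (L : fieldExtType rat) (io : {rmorphism L -> algC})
    (rs : seq L) alpha z : map io rs = conjugates alpha ->
  z \in <<1 & rs>>%VS -> galois_closure alpha (io z).
Proof.
move=> rsE zrs L' j galL' [a _ aE]; apply: range_adjoin zrs => c crs.
have : io c \in conjugates (j a) by rewrite aE -rsE map_f.
by move=> /conjugates_galP[s _ ->]; exists (s a).
Qed.

(** [D] is chosen before the factorisation, so that one finite set of measures serves all
    factorisations. The factor [z] absorbs the arbitrary choice of the roots [b i]. *)
Lemma radical_reduction (R : realType) (alpha : algC) : exists D : nat,
  forall N (a : 'I_N -> algC), (forall i, a i != 0) -> alpha = \prod_i a i ->
  exists (b c : 'I_N -> algC) (z : algC) (m : nat),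
    [/\ (0 < m)%N, z ^+ m = 1, alpha = z * \prod_i b i &
     forall i, [/\ exists2 d, (0 < d)%N & b i ^+ d = c i, c i != 0,
       galois_closure alpha (c i), (size (conjugates (c i)) <= D)%N
       & mahler R (c i) <= mahler R (a i)]].
Proof.
(* [n ^ n] bounds the degree of the field generated by the [n] conjugates of [alpha], each
   multiplying the degree by at most [n]. *)
set n := size (conjugates alpha); exists (n ^ n)%N => N a a0 aE.
have [L [io [galL hL]]] := exists_galois_number_field (alpha :: codom a).
have [rs rsE] : exists rs, map io rs = conjugates alpha.
  have : forall y, y \in conjugates alpha -> exists b, y = io b.
    by move=> y; apply: hL; rewrite mem_head.
  elim: (conjugates alpha) => [|y s IH] hs; first by exists [::].
  have [b ->] := hs y (mem_head _ _).
  have [|r <-] := IH; first by move=> y' y's; apply: hs; rewrite in_cons y's orbT.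
  by exists (b :: r).
pose K := <<1 & rs>>%AS.
have nK : normalField 1 K.
  apply/splitting_normalField; first exact: sub1v.
  exists (\prod_(c <- rs) ('X - c%:P)); last by exists rs; rewrite ?eqpxx.
  have [f [fE _] _] := minCpolyP alpha; apply/polyOver1P; exists f.
  apply: (map_inj_poly (fmorph_inj io) (rmorph0 io)).
  by rewrite map_prod_XsubC rsE -minCpoly_conjugates fE map_poly_in_alg.
have [A hA] : exists A : 'I_N -> L, forall i, a i = io (A i).
  have ex i : exists b, a i = io b.
    by apply: (hL (a i)); rewrite ?conjugates_id // in_cons codom_f orbT.
  by have [A hA] := choice ex; exists A.
have A0 i : A i != 0 by have := a0 i; rewrite hA fmorph_eq0.
have [al alrs alE] : exists2 al, al \in rs & alpha = io al.
  have : alpha \in map io rs by rewrite rsE conjugates_id.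
  by move=> /mapP[al alrs ->]; exists al.
pose H := 'Gal({:L} / K)%g.
pose c i := io (orbit_norm K (A i)); pose d i := size (orbit_seq K (A i)).
have d0 i : (0 < d i)%N.
  by rewrite /d; have := orbit_seq_id K (A i); case: (orbit_seq K (A i)).
pose b i := (d i).-root (c i).
have bc i : b i ^+ d i = c i by rewrite rootCK.
have c0 i : c i != 0 by rewrite /c fmorph_eq0 orbit_norm_neq0 ?A0.
have b0 i : b i != 0.
  by apply: contraNneq (c0 i) => bi0; rewrite -bc bi0 expr0n eqn0Ngt d0.
(* [alpha] lies in [K], so its norm is its power of exponent #|H|. The norm of [A i] is [c i ^+ k],
   that is [b i ^+ (d i * k)], and orbit-stabiliser gives the same exponent for every [i]. *)
have norm_eq : alpha ^+ #|H| = (\prod_i b i) ^+ #|H|.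
  rewrite -prodrXl.
  have -> : alpha ^+ #|H| = io (galNorm K {:L} al).
    rewrite alE -rmorphXn /=; congr (io _).
    rewrite /galNorm -prodr_const; apply: eq_bigr => h hH.
    by rewrite (fixed_gal _ hH) ?subvf //; exact: seqv_sub_adjoin.
  have -> : al = \prod_i A i.
    apply: (fmorph_inj io); rewrite -alE aE rmorph_prod.
    by apply: eq_bigr => i _; rewrite hA.
  rewrite galNorm_prod rmorph_prod; apply: eq_bigr => i _.
  have [k -> kH] := galNorm_orbit_norm K (A i).
  by rewrite rmorphXn -/(c i) -bc -exprM mulnC kH.
have pb0 : \prod_i b i != 0 by apply/prodf_neq0.
exists b, c, (alpha / \prod_i b i), #|H|; split=> [|||i].
- exact: cardG_gt0.
- by rewrite expr_div_n norm_eq mulfV // expf_neq0.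
- by rewrite divfK.
have onK : orbit_norm K (A i) \in K by exact: orbit_norm_mem.
split=> //; first by exists (d i).
- exact: galois_closure_adjoin rsE onK.
- apply: leq_trans (size_conjugates_le io _) _.
  have := dim_Fadjoin 1%AS (orbit_norm K (A i)); rewrite dimv1 muln1 => <-.
  have dK : (\dim K <= n ^ n)%N.
    have -> : n = size rs by rewrite /n -rsE size_map.
    apply: dim_adjoin_seq_le => e ers; rewrite -(size_map io) rsE.
    by apply: (adjoin_degree_le (io := io)); rewrite -rsE map_f.
  by apply: leq_trans dK; rewrite dimvS // sub_adjoin1v.
- rewrite hA; apply: mahler_le => w; exact: local_mahler_orbit_norm.
Qed.

(** * Finiteness of bounded products and attainment of the infimum *)

Lemma seq_min (R : realType) (s : seq R) : s != [::] ->
  exists2 x, x \in s & forall y, y \in s -> x <= y.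
Proof.
elim: s => [//|x [|x' s] IH] _.
  by exists x => [|y]; rewrite inE // => /eqP ->.
have [//|z zs hz] := IH; exists (Num.min x z).
  by rewrite minEle; case: ifP => _; rewrite in_cons ?eqxx // zs orbT.
move=> y; rewrite in_cons => /orP[/eqP ->|/hz zy]; first by rewrite ge_min lexx.
by rewrite ge_min zy orbT.
Qed.

(** Finitely many elements of [V] are at most [B], so those above 1 are at least some [c > 1]; once
    [c ^+ k] exceeds [B], fewer than [k] factors differ from 1. *)
Lemma finite_products (R : realType) (V : set R) (B : R) :
    (forall v, V v -> 1 <= v) -> finite_set (V `&` [set v | v <= B]) ->
  finite_set [set m | exists N (f : 'I_N -> R),
    [/\ forall i, V (f i), m = \prod_i f i & m <= B]].
Proof.
move=> V1 /finite_seqP[s sE].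
have [c c1 hc] : exists2 c : R, 1 < c & forall v, v \in s -> 1 < v -> c <= v.
  (* Without elements above 1 the condition on [c] is void, and 2 will do. *)
  have [s0|s0] := eqVneq [seq v <- s | 1 < v] [::].
    exists 2; first by rewrite ltr1n.
    move=> v vs v1; have : v \in [seq v <- s | 1 < v] by rewrite mem_filter v1.
    by rewrite s0.
  have [c] := seq_min s0; rewrite mem_filter => /andP[c1 _] hc; exists c => // v vs v1.
  by apply: hc; rewrite mem_filter v1.
have [k hk] := expr_unbounded B c1.
(* Shorter products are padded with ones, which therefore need an index. *)
pose s1 : seq R := 1 :: s.
pose T := {ffun 'I_k -> 'I_(size s1)}.
pose F (t : T) : R := \prod_j nth 1 s1 (t j).
apply: (@sub_finite_set _ _ (F @` [set: T])); last exact/finite_image/finite_finset.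
move=> _ [N [f [hf -> mB]]].
pose l := [seq v <- codom f | v != 1].
have lE : \prod_i f i = \prod_(v <- l) v.
  rewrite big_filter [RHS]big_mkcond big_map /= -big_enum; apply: eq_bigr => i _.
  by case: eqP.
have f1 i : 1 <= f i by exact: V1.
have fs i : f i \in s.
  have : [set` s] (f i); last by [].
  rewrite -sE; split=> //=; apply: le_trans mB.
  have fi0 := le_trans ler01 (f1 i).
  by rewrite (bigD1 i) //= ler_peMr //; apply: prod_ge1 => j _; exact: f1.
have ls v : v \in l -> v \in s /\ c <= v.
  rewrite mem_filter => /andP[v1 /codomP[i vE]]; rewrite vE in v1 *.
  split; first exact: fs.
  by apply: hc; [exact: fs|rewrite lt_neqAle eq_sym v1 f1].
have sl : (size l <= k)%N.
  have cl : c ^+ size l <= \prod_(v <- l) v.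
    rewrite -iter_mulr_1 -(count_predT l) -big_const_seq [leLHS]big_seq [leRHS]big_seq.
    apply: ler_prod => v /ls[_ ->]; rewrite andbT.
    by rewrite (le_trans ler01) // ltW.
  have : c ^+ size l < c ^+ k by rewrite (le_lt_trans cl) // -lE (le_lt_trans mB).
  by rewrite ltr_eXn2l // => /ltnW.
have hi j : (index (nth 1%R l j) s1 < size s1)%N.
  rewrite index_mem in_cons; case: (ltnP j (size l)) => jl.
    by have [-> _] := ls _ (mem_nth 1 jl); rewrite orbT.
  by rewrite nth_default ?eqxx.
exists [ffun j : 'I_k => Ordinal (hi j)] => //.
rewrite lE /F; under eq_bigr => j _ do rewrite ffunE /=.
transitivity (\prod_(j < k) nth 1 l j).
  by apply: eq_bigr => j _; rewrite nth_index // -index_mem hi.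
rewrite (big_nth 1) big_mkord -(subnKC sl) big_split_ord /= [X in _ * X]big1 ?mulr1 //.
by move=> j _; rewrite nth_default // leq_addr.
Qed.

Lemma rad_field_unity_root alpha z m : (0 < m)%N -> z ^+ m = 1 ->
  rad_field (galois_closure alpha) z.
Proof.
move=> m0 zm; split; last first.
  by exists m => // L f _ _; exists 1 => //; rewrite rmorph1 zm.
by apply: contra_eq_neq zm => ->; rewrite expr0n eqn0Ngt m0 eq_sym oner_eq0.
Qed.

Theorem theorem1p1 (R : realType) (alpha : algC) (alpha_neq0 : alpha != 0) :
  (exists N (a : 'I_N -> algC),
     [/\ (0 < N)%N, forall n, rad_field (galois_closure alpha) (a n),
         alpha = \prod_n a n
       & metric_mahler R alpha = \prod_n mahler R (a n)])
  /\ mahler_products R alpha (metric_mahler R alpha).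
Proof.
have [D hD] := radical_reduction R alpha.
pose rad_value (m : R) := exists N (a : 'I_N -> algC),
  [/\ (0 < N)%N, forall n, rad_field (galois_closure alpha) (a n),
      alpha = \prod_n a n & m = \prod_n mahler R (a n)].
pose V : set R := [set v | exists2 x, v = mahler R x & (size (conjugates x) <= D)%N].
pose P : set R := [set p | exists N (f : 'I_N -> R),
  (forall i, V (f i)) /\ p = \prod_i f i].
have rad_mahler m : rad_value m -> mahler_products R alpha m.
  by move=> [N [a [N0 ra aE mE]]]; exists N, a; split=> // n; case: (ra n).
have reduce m : mahler_products R alpha m ->
    exists2 p, P p /\ p <= m & exists2 m', rad_value m' & m' <= p.
  move=> [N [a [N0 a0 aE ->]]].
  have [b [c [z [k [k0 zk bE hbc]]]]] := hD N a a0 aE.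
  exists (\prod_i mahler R (c i)).
    split; first by exists N, (fun i => mahler R (c i)); split=> // i;
      exists (c i) => //; case: (hbc i).
    apply: ler_prod => i _; rewrite (le_trans ler01) ?mahler_ge1 //=.
    by case: (hbc i).
  (* The root of unity becomes an additional factor in position 0, of measure 1. *)
  pose e (i : 'I_N.+1) := if unlift ord0 i is Some j then b j else z.
  have eE (T : comNzRingType) (F : algC -> T) :
      \prod_i F (e i) = F z * \prod_i F (b i).
    rewrite big_ord_recl /e unlift_none; congr (_ * _).
    by apply: eq_bigr => i _; rewrite liftK.
  exists (\prod_i mahler R (e i)).
    exists N.+1, e; split=> //; last by rewrite (eE _ id).
    move=> i; rewrite /e; case: (unlift ord0 i) => [j|].
      have [[d d0 bd] c0 cK _ _] := hbc j; split; last by exists d; rewrite ?bd.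
      by apply: contraNneq c0 => bj0; rewrite -bd bj0 expr0n eqn0Ngt d0.
    exact: rad_field_unity_root zk.
  rewrite eE (mahler_unity_root R k0 zk) mul1r.
  apply: ler_prod => i _; rewrite (le_trans ler01) ?mahler_ge1 //=.
  by have [[d d0 <-] _ _ _ _] := hbc i; exact: mahler_root.
set m0 := metric_mahler R alpha.
have E0 : mahler_products R alpha !=set0.
  exists (mahler R alpha), 1%N, (fun=> alpha); split=> //; by rewrite big_ord1.
have Elb : has_lbound (mahler_products R alpha).
  by exists 1 => _ [N [a [_ _ _ ->]]]; apply: prod_ge1 => i _; exact: mahler_ge1.
have Efin : finite_set (P `&` [set p | p <= m0 + 1]).
  apply: (sub_finite_set _ (@finite_products R V (m0 + 1) _ _)).
  - by move=> p [[N [f [hf pE]]] pB]; exists N, f.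
  - by move=> _ [x -> _]; exact: mahler_ge1.
  - apply: sub_finite_set (northcott_mahler D (m0 + 1)) => v [[x vE sx] vB].
    by exists x.
(* Only those [p] are kept that dominate a value realised by radicals. A bound strictly above the
   infimum ensures that some remain. *)
have [s sE] : exists s : seq R, [set p | [/\ P p, p <= m0 + 1 &
    exists2 m', rad_value m' & m' <= p]] = [set` s].
  by apply/finite_seqP; apply: sub_finite_set Efin => p [].
have sP p : p \in s <-> [/\ P p, p <= m0 + 1 & exists2 m', rad_value m' & m' <= p].
  have /= e := congr1 (fun A : set R => A p) sE.
  by rewrite e.
have s0 : s != [::].
  have [m Em mlt] := inf_adherent ltr01 (conj E0 Elb).
  have [p [Pp pm] hp] := reduce m Em.
  have : p \in s by apply/sP; split=> //; rewrite (le_trans pm) // ltW.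
  by case: (s).
have [p0 /sP[_ p0B [m' rm' m'p0]] p0min] := seq_min s0.
have m'E : m0 = m'.
  apply/eqP; rewrite eq_le (ge_inf Elb (rad_mahler _ rm')) /=.
  apply: (le_trans m'p0); apply: lb_le_inf => // m Em.
  have [p [Pp pm] hp] := reduce m Em.
  (* Beyond the bound [p] exceeds [p0] at once; below it [p] belongs to [s] and minimality
     applies. *)
  have [pB|pB] := leP p (m0 + 1); last by rewrite (le_trans p0B) // (le_trans (ltW pB)).
  by apply: le_trans pm; apply: p0min; apply/sP.
by rewrite m'E; split; [exact: rm'|exact: rad_mahler].
Qed.
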